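(* For every $\sigma_x>0$ there is a (large) constant $c>0$ depending only on $\sigma_x$ such that the following holds for every instance of the setting described in the context with $\lfloor n/c\rfloor\ge1$. If $$\lambda>cn\lambda_{\lfloor n/c\rfloor}+2\sum_{i>\lfloor n/c\rfloor}\lambda_i,$$ then with probability at least $1-ce^{-n/c}$, $$B/c\le\sum_{i=1}^p\lambda_i|\theta^*_i|^2\frac{(\lambda/n)^2}{(\lambda/n+\lambda_i)^2},\qquad V/c\le\frac1n\sum_{i=1}^p\frac{\lambda_i^2}{(\lambda/n+\lambda_i)^2}.$$
   Context: Setting. $n<p$ are positive integers. $x$ is a random vector in $\mathbb R^p$ with mean zero and covariance $\Sigma=\mathbb E[xx^\top]=\mathrm{diag}(\lambda_1,\dots,\lambda_p)$, $\lambda_1\ge\dots\ge\lambda_p>0$. $X\in\mathbb R^{n\times p}$ is a random matrix with i.i.d. rows distributed as $x^\top$, and $Z=X\Sigma^{-1/2}$. The rows of $Z$ are sub-Gaussian with sub-Gaussian norm at most $\sigma_x$, where for a random variable $\|z\|_{\psi_2}=\inf\{t>0:\mathbb E\exp(z^2/t^2)\le2\}$ and for a random vector $\|z\|_{\psi_2}=\sup_{s\ne0}\|\langle s,z\rangle/\|s\|\|_{\psi_2}$. $\lambda\in\mathbb R$ is the ridge parameter (not to be confused with the eigenvalues $\lambda_i$), $\theta^*\in\mathbb R^p$ is a fixed vector. $\sum_{i>k}$ means $\sum_{i=k+1}^p$; $\|v\|_M=\sqrt{v^\top Mv}$ for $M$ positive semidefinite. $A=\lambda I_n+XX^\top$.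 Bias and variance of ridge regression: $B=\|(I_p-X^\top A^{-1}X)\theta^*\|_\Sigma^2$, $V=\mathrm{tr}(A^{-1}X\Sigma X^\top A^{-1})$ (here $\lambda>0$, so $A$ is positive definite). *)

(* Defs.v *)
From HB Require Import structures.
From mathcomp Require Export all_boot all_order all_algebra.
From mathcomp Require Export all_classical all_reals all_analysis.

Set Implicit Arguments.
Unset Strict Implicit.
Unset Printing Implicit Defensive.
Import Order.TTheory GRing.Theory Num.Theory.
Import numFieldNormedType.Exports.

Local Open Scope classical_set_scope.
Local Open Scope ring_scope.

Section linear_algebra.
Context {R : realType}.

(* [`|v|] is the sup norm on matrices, hence a separate Euclidean norm. *)
Definition l2norm p (v : 'rV[R]_p) : R := Num.sqrt (\sum_j v 0 j ^+ 2).

Definition dotrv p (u v : 'rV[R]_p) : R := \sum_j u 0 j * v 0 j.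

Definition mnorm p (M : 'M[R]_p) (v : 'cV[R]_p) : R :=
  Num.sqrt ((v^T *m M *m v) 0 0).

(* The sequence [lam] is indexed from 1: only lam 1, ..., lam p are used. *)
Definition Sigma p (lam : nat -> R) : 'M[R]_p :=
  diag_mx (\row_(j < p) lam j.+1).

Definition Sigma_invsqrt p (lam : nat -> R) : 'M[R]_p :=
  diag_mx (\row_(j < p) (Num.sqrt (lam j.+1))^-1).

Definition gramA n p (lambda : R) (X : 'M[R]_(n, p)) : 'M[R]_n :=
  lambda%:M + X *m X^T.

Definition ridge_bias n p (lam : nat -> R) (lambda : R) (theta : 'cV[R]_p)
    (X : 'M[R]_(n, p)) : R :=
  mnorm (Sigma p lam)
    ((1%:M - X^T *m invmx (gramA lambda X) *m X) *m theta) ^+ 2.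

Definition ridge_variance n p (lam : nat -> R) (lambda : R)
    (X : 'M[R]_(n, p)) : R :=
  \tr (invmx (gramA lambda X) *m X *m Sigma p lam *m X^T
       *m invmx (gramA lambda X)).

End linear_algebra.

Section probability_notions.
Context {R : realType} {d : measure_display} {T : measurableType d}.
Context (P : probability T R).

(* Values in \bar R: the infimum is +oo when no t is admissible. *)
Definition psi2_norm (z : T -> R) : \bar R :=
  ereal_inf [set t%:E | t in
    [set t : R | 0 < t /\ ('E_P[fun w => expR (z w ^+ 2 / t ^+ 2)%R] <= 2%:E)%E]].

Definition psi2_vnorm p (z : T -> 'rV[R]_p) : \bar R :=
  ereal_sup [set psi2_norm (fun w => dotrv s (z w) / l2norm s)
            | s in [set s : 'rV[R]_p | s != 0]].

(* Random vectors are random variables valued in [p.-tuple R], whose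
   sigma-algebra is the product one. *)
Definition mean_zero p (x : {RV P >-> p.-tuple R}) : Prop :=
  forall j : 'I_p, ('E_P[fun w => tnth (x w) j] = 0)%E.

Definition has_second_moment p (x : {RV P >-> p.-tuple R}) (M : 'M[R]_p) :
    Prop :=
  forall j k : 'I_p,
    ('E_P[fun w => (tnth (x w) j * tnth (x w) k)%R] = (M j k)%:E)%E.

(* Since some of the B i may be the whole space, the product rule for the
   full family contains the product rule for all subfamilies. *)
Definition mutually_independent n d' (T' : measurableType d')
    (X : 'I_n -> {RV P >-> T'}) : Prop :=
  forall B : 'I_n -> set T', (forall i, measurable (B i)) ->
    P [set w | forall i, B i (X i w)] = (\prod_(i < n) P (X i @^-1` B i))%E.

Definition data_matrix n p (X : 'I_n -> {RV P >-> p.-tuple R}) (w : T) :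
    'M[R]_(n, p) := \matrix_(i, j) tnth (X i w) j.

End probability_notions.

(* Equality is only required on measurable sets: as set functions the
   pushforwards are unconstrained elsewhere. *)
Definition same_law {R : realType} {d1 d2 d' : measure_display}
    {T1 : measurableType d1} {T2 : measurableType d2} {T' : measurableType d'}
    (P1 : probability T1 R) (P2 : probability T2 R)
    (X1 : {RV P1 >-> T'}) (X2 : {RV P2 >-> T'}) : Prop :=
  forall B : set T', measurable B ->
    distribution P1 X1 B = distribution P2 X2 B.

(* Main.v *)
Require Import Defs.
From mathcomp Require Import ring lra measurable_realfun.

(** Write [mu = lambda / n] and call an eigenvalue large when it exceeds [mu].
    By the hypothesis on [lambda], the set [a] of indices of large eigenvalues
    has at most [n / c] elements and the small eigenvalues sum to at most
    [lambda].  Split the design accordingly into a head block [Xa] and a tail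
    block [Xb].

    On an event of probability at least [1 - 5 exp (- n / c)] four estimates
    hold, with constants depending on [sigma_x] only:
    - the tail is harmless: [Xb Xb^T <= C1 lambda] ([tail_opnorm_event]);
    - the whitened head is well conditioned:
      [|Xa u|^2 >= c2 n sum_a lam_j u_j^2] ([head_event]);
    - the squared Frobenius norm of the tail weighted by the eigenvalues, and
      [|Xb theta|^2], are at most a constant times their means
      ([prob_weighted_coords_gt], [prob_direction_gt]).

    They imply the bounds deterministically.  The residual
    [r = (I - X^T A^-1 X) theta] satisfies [X^T q = lambda (theta - r)] with
    [q = X r]; eliminating its tail coordinates gives
    [Xa r + Xb theta = (1 + Xb Xb^T / lambda) q], whose operator lies between
    [1] and [1 + C1], and pairing with [q] bounds [|q|], hence both parts of
    [r] ([bias_le]).  The variance is the sum of [lam_j |A^-1 X_j|^2] over the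
    columns of [X]; a tail column costs at most [lam_j |X_j|^2 / lambda^2], a
    head column at most a constant over [n] ([variance_le]).  Since
    [(mu + lam_j)^2] is comparable with [lam_j^2] on the head and with [mu^2]
    on the tail, these are the two sums of the theorem.

    The probabilistic estimates bound quadratic forms at a fixed vector by
    exponential moments and then use finite nets.  For the tail block the form
    [|Xb^T u|^2] has to be bounded by its trace, not by its rank times the
    largest eigenvalue; writing the exponential of a square as a Gaussian
    average of exponentials of linear forms achieves this
    ([exp_quadratic_form_le]).  The net of the unit ball of R^n has
    exponentially many points in [n], which is affordable because the failure
    probability at each point can be made as small as [exp (- 7 n)].  The net
    for the head has only exponentially many points in [#|a| <= n / c], so
    deviation bounds with a rate depending on [sigma_x] suffice once [c] is
    large. *)

Set Implicit Arguments.
Unset Strict Implicit.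
Unset Printing Implicit Defensive.
Import Order.TTheory GRing.Theory Num.Theory.
Import numFieldNormedType.Exports.
Local Open Scope classical_set_scope.
Local Open Scope ring_scope.

(** * Euclidean geometry with squared norms *)

Ltac nonneg := lazymatch goal with
  | |- is_true (0 <= _ + _) => apply: addr_ge0; nonneg
  | |- is_true (0 <= _ * _) => apply: mulr_ge0; nonneg
  | |- is_true (0 <= _^-1) => rewrite invr_ge0; nonneg
  | |- is_true (0 <= _ ^+ 2) => exact: sqr_ge0
  | |- is_true (0 <= _%:R) => exact: ler0n
  | |- is_true (0 <= 1) => exact: ler01
  | _ => first [assumption | apply: ltW; assumption]
  end.

Section euclidean.
Context {R : realType}.

Definition dot m (u v : 'cV[R]_m) : R := \sum_i u i 0 * v i 0.
Definition nsq m (v : 'cV[R]_m) : R := \sum_i v i 0 ^+ 2.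

Lemma nsq_ge0 m (v : 'cV[R]_m) : 0 <= nsq v.
Proof. by apply: sumr_ge0 => i _; exact: sqr_ge0. Qed.

Lemma nsqE m (v : 'cV[R]_m) : nsq v = dot v v.
Proof. by apply: eq_bigr => i _; rewrite expr2. Qed.

Lemma dotC m (u v : 'cV[R]_m) : dot u v = dot v u.
Proof. by apply: eq_bigr => i _; rewrite mulrC. Qed.

Lemma dotDr m (u v w : 'cV[R]_m) : dot u (v + w) = dot u v + dot u w.
Proof. by rewrite -big_split; apply: eq_bigr => i _; rewrite mxE mulrDr. Qed.

Lemma dotZr m k (u v : 'cV[R]_m) : dot u (k *: v) = k * dot u v.
Proof. by rewrite mulr_sumr; apply: eq_bigr => i _; rewrite mxE; ring. Qed.

Lemma dotDl m (u v w : 'cV[R]_m) : dot (u + v) w = dot u w + dot v w.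
Proof. by rewrite dotC dotDr !(dotC w). Qed.

Lemma dotZl m k (u v : 'cV[R]_m) : dot (k *: u) v = k * dot u v.
Proof. by rewrite dotC dotZr dotC. Qed.

Lemma dot_mulmx m m' (u : 'cV[R]_m) (M : 'M[R]_(m, m')) v :
  dot u (M *m v) = dot (M^T *m u) v.
Proof.
rewrite /dot.
under eq_bigr do rewrite mxE mulr_sumr.
rewrite exchange_big; apply: eq_bigr => j _ /=.
by rewrite mxE mulr_suml; apply: eq_bigr => i _; rewrite mxE; ring.
Qed.

Lemma nsqZ m k (v : 'cV[R]_m) : nsq (k *: v) = k ^+ 2 * nsq v.
Proof. by rewrite !nsqE dotZl dotZr; ring. Qed.

Lemma nsqD_le m (u v : 'cV[R]_m) : nsq (u + v) <= 2 * nsq u + 2 * nsq v.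
Proof.
rewrite /nsq !mulr_sumr -big_split; apply: ler_sum => i _; rewrite mxE /=.
by have := sqr_ge0 (u i 0 - v i 0); nra.
Qed.

Lemma nsq_eq0 m (v : 'cV[R]_m) : nsq v <= 0 -> v = 0.
Proof.
move=> v0; apply/matrixP => i j; rewrite ord1 mxE; apply/eqP.
rewrite -sqrf_eq0 eq_le sqr_ge0 andbT (le_trans _ v0)//.
rewrite /nsq (bigD1 i)//= lerDl.
by apply: sumr_ge0 => k _; exact: sqr_ge0.
Qed.

(** Used in place of the Cauchy-Schwarz inequality, so that all estimates stay
    polynomial in squared norms and no square root has to be taken. *)
Lemma dot_amgm m (e : R) (u v : 'cV[R]_m) : 0 < e ->
  2 * dot u v <= e * nsq u + e^-1 * nsq v.
Proof.
move=> e0; rewrite !mulr_sumr -big_split; apply: ler_sum => i _ /=.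
set x := u i 0; set y := v i 0; rewrite -subr_ge0.
have -> : e * x ^+ 2 + e^-1 * y ^+ 2 - 2 * (x * y) = e^-1 * (e * x - y) ^+ 2.
  by field; rewrite gt_eqF.
by rewrite mulr_ge0 ?invr_ge0 ?sqr_ge0// ltW.
Qed.

(** With [z = M y] one has [|z|^2 = <y, M^T z>]; the AM-GM inequality with
    weight [C] absorbs half of it into [|M^T z|^2 <= C |z|^2]. *)
Lemma nsq_mulmx_dual m m' (M : 'M[R]_(m, m')) (C : R) : 0 < C ->
  (forall v : 'cV[R]_m, nsq (M^T *m v) <= C * nsq v) ->
  forall y, nsq (M *m y) <= C * nsq y.
Proof.
move=> C0 H y; have := H (M *m y).
have := dot_amgm y (M^T *m (M *m y)) C0.
rewrite (dotC y) -dot_mulmx -nsqE => h1 h2.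
have : C^-1 * nsq (M^T *m (M *m y)) <= nsq (M *m y).
  by rewrite mulrC ler_pdivrMr// mulrC.
by lra.
Qed.

(** Multiplying by [mask a] deletes the coordinates outside [a] while keeping
    the width [p], so that no block decomposition of matrices is needed. *)
Definition mask p (a : pred 'I_p) : 'M[R]_p := diag_mx (\row_j (a j)%:R).

Lemma mask_tr p (a : pred 'I_p) : (mask a)^T = mask a.
Proof. exact: tr_diag_mx. Qed.

Lemma mask_mulE p (a : pred 'I_p) (u : 'cV[R]_p) j :
  (mask a *m u) j 0 = (a j)%:R * u j 0.
Proof. by rewrite mul_diag_mx !mxE. Qed.

Lemma mul_maskE n p (a : pred 'I_p) (X : 'M[R]_(n, p)) i j :
  (X *m mask a) i j = X i j * (a j)%:R.
Proof. by rewrite mul_mx_diag !mxE. Qed.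

Lemma maskDC n p (a : pred 'I_p) (X : 'M[R]_(n, p)) :
  X = X *m mask a + X *m mask (predC a).
Proof.
apply/matrixP => i j; rewrite mxE !mul_maskE /=.
by case: (a j); rewrite ?mulr1 ?mulr0 ?addr0 ?add0r.
Qed.

Lemma sum_maskl p (a : pred 'I_p) (F : 'I_p -> R) :
  \sum_(j | a j) F j = \sum_j (a j)%:R * F j.
Proof.
by rewrite big_mkcond; apply: eq_bigr => j _; case: (a j);
  rewrite ?mul1r ?mul0r.
Qed.

End euclidean.

(** * Bias and variance of a design with good blocks *)

Section deterministic.
Context {R : realType}.
Variables (n p : nat) (l : 'I_p -> R) (lambda : R) (a : pred 'I_p).
Variables (X : 'M[R]_(n, p)) (C1 c2 C3 C4 : R).
Hypotheses (n0 : (0 < n)%N) (l0 : forall j, 0 < l j) (lambda0 : 0 < lambda).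
Hypotheses (C10 : 0 < C1) (c20 : 0 < c2) (C30 : 0 <= C3) (C40 : 0 <= C4).
Let Xa := X *m mask a.
Let Xb := X *m mask (predC a).
Hypothesis H1 : forall v : 'cV[R]_n, nsq (Xb^T *m v) <= C1 * lambda * nsq v.
Hypothesis H2 : forall u : 'cV[R]_p,
  c2 * n%:R * (\sum_(j | a j) l j * u j 0 ^+ 2) <= nsq (Xa *m u).

Let A := gramA lambda X.
Let nR : 0 < n%:R :> R. Proof. by rewrite ltr0n. Qed.

Lemma gramA_tr : A^T = A.
Proof. by rewrite /A /gramA linearD /= tr_scalar_mx trmx_mul trmxK. Qed.

Lemma gramA_mul (u : 'cV[R]_n) : A *m u = lambda *: u + X *m (X^T *m u).
Proof. by rewrite /A /gramA mulmxDl mul_scalar_mx mulmxA. Qed.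

(** The cross term of [|lambda u + X X^T u|^2] is
    [2 lambda |X^T u|^2 >= 0]. *)
Lemma gramA_nsq (u : 'cV[R]_n) : lambda ^+ 2 * nsq u <= nsq (A *m u).
Proof.
rewrite gramA_mul; set z := X *m _.
have -> : nsq (lambda *: u + z) =
    lambda ^+ 2 * nsq u + 2 * lambda * dot u z + nsq z.
  by rewrite !nsqE !dotDl !dotDr !dotZl !dotZr (dotC z u); ring.
have -> : dot u z = nsq (X^T *m u) by rewrite /z dot_mulmx nsqE.
by rewrite -addrA lerDl addr_ge0 ?nsq_ge0// !mulr_ge0 ?nsq_ge0// ltW.
Qed.

Lemma gramA_unit : A \in unitmx.
Proof.
rewrite -unitmx_tr -row_free_unit -kermx_eq0; apply/eqP/row_matrixP => i.
rewrite row0; set r := row i _.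
have : r *m A^T = 0 by rewrite /r -row_mul mulmx_ker row0.
move=> /(congr1 trmx); rewrite trmx_mul trmxK trmx0 => Ar.
have := gramA_nsq r^T; rewrite Ar.
have -> : nsq (0 : 'cV[R]_n) = 0.
  by rewrite /nsq big1// => k _; rewrite mxE expr0n.
rewrite pmulr_rle0 ?exprn_gt0// => /nsq_eq0 /(congr1 trmx).
by rewrite trmxK trmx0.
Qed.

Lemma Xb_XbT_nsq (v : 'cV[R]_n) : nsq (Xb *m (Xb^T *m v)) <= (C1 * lambda) ^+ 2 * nsq v.
Proof.
have Cl : 0 < C1 * lambda by rewrite mulr_gt0.
apply: (le_trans (nsq_mulmx_dual Cl H1 _)).
by rewrite [leRHS](_ : _ = C1 * lambda * (C1 * lambda * nsq v)) ?ler_pM2l//; ring.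
Qed.

Lemma sum_split_mask (F : 'I_p -> R) :
  \sum_j F j = \sum_(j | a j) F j + \sum_(j | ~~ a j) F j.
Proof. exact: (bigID a). Qed.

Section bias.
Variable theta : 'cV[R]_p.
Let B2 := \sum_(j | ~~ a j) l j * theta j 0 ^+ 2.
Let T2 := \sum_(j | a j) theta j 0 ^+ 2 / l j.
Hypothesis H4 : nsq (Xb *m theta) <= C4 * n%:R * B2.
Hypothesis Hb : forall j, ~~ a j -> l j * n%:R <= lambda.
Let r := (1%:M - X^T *m invmx A *m X) *m theta.
Let q := X *m r.

(** The fitted vector is [theta - r = X^T A^-1 X theta], and
    [q = X r = lambda A^-1 X theta] because [1 - X X^T A^-1 = lambda A^-1]. *)
Lemma resid_normal_eq : X^T *m q = lambda *: (theta - r).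
Proof.
have -> : theta - r = X^T *m (invmx A *m (X *m theta)).
  by rewrite /r mulmxBl mul1mx opprB addrC subrK !mulmxA.
have -> : q = lambda *: (invmx A *m (X *m theta)).
  rewrite /q /r mulmxBl mul1mx mulmxBr.
  rewrite -!mulmxA; set y := X *m theta.
  have {1}-> : y = A *m (invmx A *m y) by rewrite mulKVmx// gramA_unit.
  by rewrite gramA_mul addrK.
by rewrite -scalemxAr.
Qed.

Lemma residE j : r j 0 = theta j 0 - lambda^-1 * (X^T *m q) j 0.
Proof.
rewrite resid_normal_eq [(_ *: _ : 'cV[R]_p) j 0]mxE.
rewrite [(_ + _ : 'cV[R]_p) j 0]mxE [(- _ : 'cV[R]_p) j 0]mxE.
by field; rewrite gt_eqF.
Qed.

(** Only the tail coordinates of [r] are eliminated with [residE]: the head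
    coordinates remain as unknowns, since [Xa Xa^T] is not bounded by a
    multiple of [lambda]. *)
Lemma bias_masked_normal_eq :
  Xa *m r + Xb *m theta = q + lambda^-1 *: (Xb *m (Xb^T *m q)).
Proof.
have qE : q = Xa *m r + Xb *m r by rewrite -mulmxDl -maskDC.
rewrite {1}qE -addrA; congr (_ + _).
have -> : Xb *m (Xb^T *m q) = Xb *m (X^T *m q).
  rewrite /Xb trmx_mul mask_tr -!mulmxA; congr (_ *m _).
  apply/matrixP => j k; rewrite ord1 !mask_mulE.
  by case: (predC a j); rewrite ?mul1r ?mul0r.
have {1}-> : theta = r + lambda^-1 *: (X^T *m q).
  apply/matrixP => j k; rewrite ord1 mxE [(_ *: _ : 'cV[R]_p) j 0]mxE.
  by rewrite {1}residE subrK.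
by rewrite mulmxDr -scalemxAr.
Qed.

Let K := 4 * (1 + C1 ^+ 2) / c2.

(** The masked equation expresses [Xa r] through [q], up to a factor
    [1 + C1]; the lower bound on the head block then controls the head of
    [r]. *)
Lemma bias_head_le_q :
  c2 * n%:R * (\sum_(j | a j) l j * r j 0 ^+ 2) <=
  4 * (1 + C1 ^+ 2) * nsq q + 2 * (C4 * n%:R * B2).
Proof.
apply: (le_trans (H2 r)).
have -> : Xa *m r = q + lambda^-1 *: (Xb *m (Xb^T *m q)) + (- 1) *: (Xb *m theta).
  by rewrite -bias_masked_normal_eq scaleN1r addrK.
apply: (le_trans (nsqD_le _ _)); rewrite nsqZ sqrrN expr1n mul1r.
apply: lerD; last by rewrite ler_pM2l.
rewrite (_ : 4 * _ * _ = 2 * (2 * nsq q + 2 * (C1 ^+ 2 * nsq q))); last by ring.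
rewrite ler_pM2l// (le_trans (nsqD_le _ _))// lerD2l ler_pM2l// nsqZ.
have := Xb_XbT_nsq q; rewrite exprMn exprVn.
move=> h; rewrite ler_pdivrMl ?exprn_gt0// (le_trans h)//.
by rewrite (_ : _ * _ = lambda ^+ 2 * (C1 ^+ 2 * nsq q))//; ring.
Qed.

(** Pairing the masked equation with [q] gives
    [|q|^2 <= lambda <theta_a, r_a> + <q, Xb theta>].  The head of [r] is itself
    bounded by [|q|], so the first term is split with a weight [eta] that is
    small enough for half of [|q|^2] to absorb what comes back. *)
Lemma bias_q_le :
  nsq q <= 2 * K * (lambda ^+ 2 / n%:R * T2) + 3 * (C4 * n%:R * B2).
Proof.
pose eta := c2 * n%:R / (8 * (1 + C1 ^+ 2)).
have C1p : 0 < 1 + C1 ^+ 2 by rewrite ltr_wpDr ?sqr_ge0.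
have eta0 : 0 < eta by rewrite divr_gt0 ?mulr_gt0.
set N := \sum_(j | a j) l j * r j 0 ^+ 2.
set s := \sum_(j | a j) theta j 0 * r j 0.
(* pairing the masked normal equations with q *)
have Qle : nsq q <= lambda * s + dot q (Xb *m theta).
  have : dot q (Xa *m r + Xb *m theta) =
         nsq q + lambda^-1 * nsq (Xb^T *m q).
    by rewrite bias_masked_normal_eq dotDr -nsqE dotZr dot_mulmx -nsqE.
  rewrite dotDr => e.
  have -> : lambda * s = dot q (Xa *m r) + lambda * \sum_(j | a j) r j 0 ^+ 2.
    rewrite dot_mulmx /Xa trmx_mul mask_tr -mulmxA resid_normal_eq.
    rewrite /s /dot !(sum_maskl a) !mulr_sumr -big_split; apply: eq_bigr => j _ /=.
    rewrite mask_mulE [(_ *: _ : 'cV[R]_p) j 0]mxE [(_ + _ : 'cV[R]_p) j 0]mxE.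
    by rewrite [(- _ : 'cV[R]_p) j 0]mxE; ring.
  have : 0 <= lambda * \sum_(j | a j) r j 0 ^+ 2.
    by rewrite mulr_ge0 ?(ltW lambda0)// sumr_ge0// => j _; exact: sqr_ge0.
  have : 0 <= lambda^-1 * nsq (Xb^T *m q).
    by rewrite mulr_ge0 ?nsq_ge0// ?invr_ge0 ltW.
  lra.
have dle : dot q (Xb *m theta) <= nsq q / 4 + C4 * n%:R * B2.
  have h2 : 0 < 2^-1 :> R by rewrite invr_gt0.
  by have := dot_amgm q (Xb *m theta) h2; rewrite invrK; move: H4; lra.
have sle : 2 * (lambda * s) <= eta^-1 * (lambda ^+ 2 * T2) + eta * N.
  rewrite /s /T2 /N !mulr_sumr -big_split; apply: ler_sum => j _ /=.
  rewrite -subr_ge0.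
  have -> : eta^-1 * (lambda ^+ 2 * (theta j 0 ^+ 2 / l j)) +
      eta * (l j * r j 0 ^+ 2) - 2 * (lambda * (theta j 0 * r j 0)) =
      (eta * l j)^-1 * (lambda * theta j 0 - eta * l j * r j 0) ^+ 2.
    by field; rewrite !gt_eqF ?l0.
  by rewrite mulr_ge0 ?sqr_ge0// invr_ge0 mulr_ge0 ?ltW ?l0.
have etaN : eta * N <= nsq q / 2 + C4 * n%:R * B2 / 4.
  have := bias_head_le_q; rewrite -/N => h.
  have -> : eta * N = c2 * n%:R * N / (8 * (1 + C1 ^+ 2)) by rewrite /eta; ring.
  rewrite ler_pdivrMr ?mulr_gt0// (le_trans h)//.
  have : 0 <= C4 * n%:R * B2 by apply: le_trans H4; exact: nsq_ge0.
  by have := nsq_ge0 q; have := sqr_ge0 C1; nra.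
have etaT : eta^-1 * (lambda ^+ 2 * T2) = 2 * K * (lambda ^+ 2 / n%:R * T2).
  by rewrite /eta /K; field; rewrite !gt_eqF.
have : 0 <= C4 * n%:R * B2 by apply: le_trans H4; exact: nsq_ge0.
lra.
Qed.

Definition bias_const := (K + 2 * C1) * (2 * K + 3 * C4) + 2 * C4 / c2 + 2.

Lemma bias_const_ge0 : 0 <= bias_const.
Proof. by rewrite /bias_const /K; nonneg. Qed.

(** The tail of [r] differs from that of [theta] by [Xb^T q / lambda], whose
    Sigma-norm is small because tail eigenvalues are at most
    [lambda / n]. *)
Lemma bias_le :
  \sum_j l j * r j 0 ^+ 2 <= bias_const * ((lambda / n%:R) ^+ 2 * T2 + B2).
Proof.
have B20 : 0 <= B2.
  by apply: sumr_ge0 => j _; rewrite mulr_ge0 ?sqr_ge0// ltW.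
have T20 : 0 <= T2.
  by apply: sumr_ge0 => j _; rewrite mulr_ge0 ?sqr_ge0// invr_ge0 ltW.
have K0 : 0 <= K by rewrite divr_ge0 ?(ltW c20)// mulr_ge0// addr_ge0 ?sqr_ge0.
set F := (lambda / n%:R) ^+ 2 * T2.
have F0 : 0 <= F by rewrite mulr_ge0 ?sqr_ge0.
pose Q := nsq q / n%:R.
have Q0 : 0 <= Q by rewrite divr_ge0 ?nsq_ge0 ?ltW.
have QE : nsq q = Q * n%:R by rewrite /Q divfK// gt_eqF.
have Qle : Q <= 2 * K * F + 3 * C4 * B2.
  rewrite ler_pdivrMr// (le_trans bias_q_le)// le_eqVlt; apply/orP; left.
  by apply/eqP; rewrite /F; field; rewrite gt_eqF.
have head : \sum_(j | a j) l j * r j 0 ^+ 2 <= K * Q + 2 * C4 / c2 * B2.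
  rewrite -(ler_pM2l (_ : 0 < c2 * n%:R)) ?mulr_gt0//.
  rewrite (le_trans bias_head_le_q)// QE le_eqVlt; apply/orP; left.
  by apply/eqP; rewrite /K; field; rewrite gt_eqF.
have tail : \sum_(j | ~~ a j) l j * r j 0 ^+ 2 <= 2 * B2 + 2 * C1 * Q.
  have : \sum_(j | ~~ a j) l j * (lambda^-1 * (X^T *m q) j 0) ^+ 2 <= C1 * Q.
    apply: (@le_trans _ _ ((lambda * n%:R)^-1 * nsq (Xb^T *m q))).
      rewrite /Xb trmx_mul mask_tr -mulmxA mulr_sumr [leLHS](sum_maskl (predC a)).
      apply: ler_sum => j _; rewrite mask_mulE /=.
      case: (boolP (a j)) => [_|aj]; rewrite ?mul0r ?expr0n ?mulr0// !mul1r.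
      rewrite exprMn mulrA ler_wpM2r ?sqr_ge0// exprVn.
      rewrite ler_pdivrMr ?exprn_gt0//.
      have -> : (lambda * n%:R)^-1 * lambda ^+ 2 = lambda / n%:R.
        by field; rewrite !gt_eqF.
      by rewrite ler_pdivlMr// Hb.
    rewrite ler_pdivrMl ?mulr_gt0// (le_trans (H1 q))// QE.
    by rewrite le_eqVlt; apply/orP; left; apply/eqP; ring.
  move=> h; apply: (@le_trans _ _ (\sum_(j | ~~ a j) (2 * (l j * theta j 0 ^+ 2)
      + 2 * (l j * (lambda^-1 * (X^T *m q) j 0) ^+ 2)))).
    apply: ler_sum => j _; rewrite residE.
    set x := theta j 0; set y := lambda^-1 * _.
    have -> : 2 * (l j * x ^+ 2) + 2 * (l j * y ^+ 2) =
       l j * (2 * x ^+ 2 + 2 * y ^+ 2) by ring.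
    by rewrite ler_pM2l//; have := sqr_ge0 (x + y); nra.
  by rewrite big_split -!mulr_sumr /= -/B2; lra.
have C1Q : (K + 2 * C1) * Q <= (K + 2 * C1) * (2 * K * F + 3 * C4 * B2).
  by rewrite ler_wpM2l// addr_ge0// mulr_ge0// ltW.
have c2F : 0 <= 2 * C4 / c2 * F by nonneg.
have e : 0 <= (K + 2 * C1) * (3 * C4 * F + 2 * K * B2).
  by nonneg.
rewrite sum_split_mask /bias_const; lra.
Qed.

End bias.

Section variance.
Hypothesis H3 : \sum_(j | ~~ a j) l j * nsq (col j X) <=
  C3 * n%:R * \sum_(j | ~~ a j) l j ^+ 2.

(** [A^-1] shrinks norms by at least the factor [lambda]. *)
Lemma variance_tail_le :
  \sum_(j | ~~ a j) l j * nsq (invmx A *m col j X) <=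
  C3 * n%:R / lambda ^+ 2 * \sum_(j | ~~ a j) l j ^+ 2.
Proof.
rewrite [leRHS](_ : _ = (lambda ^+ 2)^-1 *
  (C3 * n%:R * \sum_(j | ~~ a j) l j ^+ 2)); last by ring.
rewrite ler_pdivlMl ?exprn_gt0// (le_trans _ H3)// mulr_sumr.
apply: ler_sum => j _; rewrite mulrCA ler_pM2l//.
by rewrite (le_trans (gramA_nsq _))// mulKVmx// gramA_unit.
Qed.

(** For [v = A^-1 X_j] and [u = A^-1 v] the [j]-th coordinate of [X^T u] is
    [|v|^2], while [Xa Xa^T u = v - lambda u - Xb Xb^T u] has norm at most a
    constant times [|v|].  The lower bound on the head block compares the two
    and yields [n lam_j |v|^4 <= C |v|^2]. *)
Lemma variance_head_le j : a j ->
  c2 * n%:R * (l j * nsq (invmx A *m col j X)) <= 6 + 4 * C1 ^+ 2.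
Proof.
move=> aj; set v := invmx A *m _; pose u := invmx A *m v.
have Au : A *m u = v by rewrite /u mulKVmx// gramA_unit.
have vE : nsq v = (X^T *m u) j 0.
  rewrite nsqE {2}/v dot_mulmx trmx_inv gramA_tr -/u /dot mxE.
  by apply: eq_bigr => i _; rewrite !mxE mulrC.
have XaE : Xa *m (X^T *m u) =
    v + ((- lambda) *: u + (- 1) *: (Xb *m (Xb^T *m u))).
  have XbE : Xb *m (Xb^T *m u) = Xb *m (X^T *m u).
    rewrite /Xb trmx_mul mask_tr -!mulmxA; congr (_ *m _).
    apply/matrixP => i k; rewrite ord1 !mask_mulE.
    by case: (predC a i); rewrite ?mul1r ?mul0r.
  rewrite -Au gramA_mul XbE {2}(maskDC a X) mulmxDl scaleN1r scaleNr.
  by rewrite addrACA subrr add0r addrK.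
have : c2 * n%:R * (l j * nsq v ^+ 2) <= (6 + 4 * C1 ^+ 2) * nsq v.
  apply: (le_trans _ (_ : nsq (Xa *m (X^T *m u)) <= _)).
    apply: (le_trans _ (H2 _)); rewrite ler_pM2l ?mulr_gt0// (bigD1 j)//= -vE.
    by rewrite lerDl sumr_ge0// => k _; rewrite mulr_ge0 ?sqr_ge0// ltW.
  have lu : lambda ^+ 2 * nsq u <= nsq v by rewrite -Au gramA_nsq.
  have Cu : nsq (Xb *m (Xb^T *m u)) <= C1 ^+ 2 * nsq v.
    by rewrite (le_trans (Xb_XbT_nsq _))// exprMn -mulrA ler_pM2l ?exprn_gt0.
  rewrite XaE (le_trans (nsqD_le _ _))//.
  have := nsqD_le (- lambda *: u) ((- 1) *: (Xb *m (Xb^T *m u))).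
  by rewrite !nsqZ !sqrrN expr1n mul1r; lra.
have [->|v0] := eqVneq (nsq v) 0.
  by rewrite !mulr0 => _; rewrite addr_ge0// mulr_ge0// sqr_ge0.
have vp : 0 < nsq v by rewrite lt_neqAle eq_sym v0 nsq_ge0.
by rewrite expr2 !mulrA ler_pM2r.
Qed.

Lemma variance_le :
  \sum_j l j * nsq (invmx A *m col j X) <=
  (6 + 4 * C1 ^+ 2) / c2 / n%:R * (\sum_(j | a j) 1) +
  C3 * n%:R / lambda ^+ 2 * \sum_(j | ~~ a j) l j ^+ 2.
Proof.
rewrite sum_split_mask; apply: lerD; last exact: variance_tail_le.
rewrite mulr_sumr; apply: ler_sum => j aj.
rewrite mulr1 -mulrA -invfM ler_pdivlMr ?mulr_gt0//.
by rewrite mulrC variance_head_le.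
Qed.

End variance.
End deterministic.

Lemma weight_head_le (R : realType) (D C x : R) :
  0 <= D -> 0 <= C -> 1 <= 4 * x -> D <= 4 * (D + C) * x.
Proof.
move=> D0 C0 x1; have h1 : 0 <= D * (4 * x - 1) by rewrite mulr_ge0 ?subr_ge0.
have h2 : 0 <= C * (4 * x - 1) by rewrite mulr_ge0 ?subr_ge0.
by lra.
Qed.

Lemma weight_tail_le (R : realType) (D C x y : R) :
  0 <= D -> 0 <= C -> 0 <= x -> x <= 4 * y -> C * x <= 4 * (D + C) * y.
Proof.
move=> D0 C0 x0 xy; have h1 : 0 <= C * (4 * y - x) by rewrite mulr_ge0 ?subr_ge0.
have h2 : 0 <= D * y by rewrite mulr_ge0//; lra.
by lra.
Qed.

Section ridge.
Context {R : realType}.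
Variables (n p : nat) (lam : nat -> R) (lambda : R).
Variables (X : 'M[R]_(n, p)).
Hypotheses (n0 : (0 < n)%N) (l0 : forall j : 'I_p, 0 < lam j.+1).
Hypothesis (lambda0 : 0 < lambda).
Let l (j : 'I_p) := lam j.+1.
Let A := gramA lambda X.

Lemma mnorm_SigmaE (v : 'cV[R]_p) :
  mnorm (Sigma p lam) v ^+ 2 = \sum_j l j * v j 0 ^+ 2.
Proof.
rewrite /mnorm; have -> : (v^T *m Sigma p lam *m v) 0 0 =
    \sum_j l j * v j 0 ^+ 2.
  by rewrite mxE; apply: eq_bigr => j _; rewrite mul_mx_diag !mxE /l; ring.
by rewrite sqr_sqrtr// sumr_ge0// => j _; rewrite mulr_ge0 ?sqr_ge0// (ltW (l0 j)).
Qed.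

Lemma ridge_varianceE :
  ridge_variance lam lambda X =
  \sum_j l j * nsq (invmx A *m col j X).
Proof.
rewrite /ridge_variance -/A.
have At : (invmx A)^T = invmx A by rewrite trmx_inv /A gramA_tr.
have -> : invmx A *m X *m Sigma p lam *m X^T *m invmx A =
    invmx A *m X *m Sigma p lam *m (invmx A *m X)^T.
  by rewrite trmx_mul At mulmxA.
rewrite /mxtrace; under eq_bigr => i _ do rewrite mxE.
rewrite exchange_big; apply: eq_bigr => j _ /=.
rewrite /nsq mulr_sumr; apply: eq_bigr => i _.
rewrite mul_mx_diag !mxE; under [X in _ = _ * X ^+ 2]eq_bigr do rewrite mxE.
by rewrite /l; ring.
Qed.

Let a (j : 'I_p) := lambda / n%:R < lam j.+1.
Let nR : 0 < n%:R :> R. Proof. by rewrite ltr0n. Qed.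
Let mu0 : 0 < lambda / n%:R. Proof. by rewrite divr_gt0. Qed.

Variables (C1 c2 C3 C4 : R).
Hypotheses (C10 : 0 < C1) (c20 : 0 < c2) (C30 : 0 <= C3) (C40 : 0 <= C4).
Let Xa := X *m mask a.
Let Xb := X *m mask (predC a).
Hypothesis H1 : forall v : 'cV[R]_n, nsq (Xb^T *m v) <= C1 * lambda * nsq v.
Hypothesis H2 : forall u : 'cV[R]_p,
  c2 * n%:R * (\sum_(j | a j) l j * u j 0 ^+ 2) <= nsq (Xa *m u).
Hypothesis H3 : \sum_(j | ~~ a j) l j * nsq (col j X) <=
  C3 * n%:R * \sum_(j | ~~ a j) l j ^+ 2.

(** [(mu + lam_j)^2 <= 4 max (mu, lam_j)^2] accounts for the factor 4 between
    the block sums and the sums over all eigenvalues. *)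
Lemma ridge_bias_le (theta : 'cV[R]_p) :
  nsq (Xb *m theta) <=
    C4 * n%:R * (\sum_(j | ~~ a j) l j * theta j 0 ^+ 2) ->
  ridge_bias lam lambda theta X <= 4 * bias_const C1 c2 C4 *
    \sum_(i < p) lam i.+1 * `|theta i 0| ^+ 2 *
           ((lambda / n%:R) ^+ 2 / (lambda / n%:R + lam i.+1) ^+ 2).
Proof.
move=> H4; rewrite /ridge_bias mnorm_SigmaE.
have Hb j : ~~ a j -> l j * n%:R <= lambda.
  by rewrite -leNgt ler_pdivlMr.
apply: (le_trans (bias_le n0 l0 lambda0 C10 c20 C40 H1 H2 H4 Hb)).
rewrite (mulrC 4) -[leRHS]mulrA; apply: ler_wpM2l.
  exact: bias_const_ge0.
rewrite [in leRHS](bigID a) /= mulrDr !mulr_sumr.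
have H j : `|theta j 0| ^+ 2 = theta j 0 ^+ 2 by rewrite real_normK// num_real.
apply: lerD; apply: ler_sum => j; rewrite /a => aj; rewrite H.
  rewrite -subr_ge0; have m0 := mu0; set m := lambda / n%:R in aj m0 *; set t := theta j 0.
  have -> : 4 * (lam j.+1 * t ^+ 2 * (m ^+ 2 / (m + lam j.+1) ^+ 2)) -
      m ^+ 2 * (t ^+ 2 / lam j.+1) = (t * m) ^+ 2 *
      ((4 * lam j.+1 ^+ 2 - (m + lam j.+1) ^+ 2)
        / (lam j.+1 * (m + lam j.+1) ^+ 2)).
    by field; rewrite !gt_eqF ?addr_gt0.
  rewrite mulr_ge0 ?sqr_ge0// divr_ge0//; last first.
    by rewrite mulr_ge0 ?sqr_ge0// ltW.
  by rewrite subr_ge0; have := l0 j; nra.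
rewrite -leNgt in aj.
rewrite -subr_ge0; have m0 := mu0; set m := lambda / n%:R in aj m0 *; set t := theta j 0.
have -> : 4 * (lam j.+1 * t ^+ 2 * (m ^+ 2 / (m + lam j.+1) ^+ 2)) -
    lam j.+1 * t ^+ 2 = (t ^+ 2 * lam j.+1) *
    ((4 * m ^+ 2 - (m + lam j.+1) ^+ 2) / (m + lam j.+1) ^+ 2).
  by field; rewrite !gt_eqF ?addr_gt0.
rewrite mulr_ge0 ?divr_ge0 ?sqr_ge0//.
  by rewrite mulr_ge0 ?sqr_ge0// ltW.
by rewrite subr_ge0; have := l0 j; nra.
Qed.

Lemma ridge_variance_le :
  ridge_variance lam lambda X <= 4 * ((6 + 4 * C1 ^+ 2) / c2 + C3) *
    (n%:R^-1 * \sum_(i < p)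
       (lam i.+1 ^+ 2 / (lambda / n%:R + lam i.+1) ^+ 2)).
Proof.
rewrite ridge_varianceE.
apply: (le_trans (variance_le n0 l0 lambda0 C10 c20 H1 H2 H3)).
set D := (6 + 4 * C1 ^+ 2) / c2.
have D0 : 0 <= D by rewrite /D; nonneg.
set E := 4 * (D + C3).
rewrite [in leRHS](bigID a) /= !mulrDr.
apply: lerD; rewrite !mulr_sumr; apply: ler_sum => j; rewrite /a => aj.
  rewrite mulr1 [leRHS](_ : _ = E *
    (lam j.+1 ^+ 2 / (lambda / n%:R + lam j.+1) ^+ 2) / n%:R); last by ring.
  rewrite ler_pM2r ?invr_gt0//.
  have m0 := mu0; set m := lambda / n%:R in aj m0 *.
  have : 1 <= 4 * (lam j.+1 ^+ 2 / (m + lam j.+1) ^+ 2).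
    rewrite mulrA ler_pdivlMr ?exprn_gt0 ?addr_gt0// mul1r.
    by have := l0 j; nra.
  exact: weight_head_le.
rewrite -leNgt in aj.
rewrite [leRHS](_ : _ = E *
    (lam j.+1 ^+ 2 / (lambda / n%:R + lam j.+1) ^+ 2) / n%:R); last by ring.
rewrite [leLHS](_ : _ = C3 * (lam j.+1 ^+ 2 / (lambda / n%:R) ^+ 2) / n%:R);
  last by rewrite /l; field; rewrite !gt_eqF.
rewrite ler_pM2r ?invr_gt0//.
have m0 := mu0; set m := lambda / n%:R in aj m0 *.
have h : lam j.+1 ^+ 2 / m ^+ 2 <= 4 * (lam j.+1 ^+ 2 / (m + lam j.+1) ^+ 2).
  rewrite mulrCA ler_pM2l ?exprn_gt0//.
  rewrite ler_pdivlMr ?exprn_gt0 ?addr_gt0// ler_pdivrMl ?exprn_gt0//.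
  by have := l0 j; nra.
have h0 : 0 <= lam j.+1 ^+ 2 / m ^+ 2 by nonneg.
exact: weight_tail_le.
Qed.

End ridge.

(** * Independence and expectations of products *)

Section independence.
Import HBNNSimple.
Context {R : realType} {d : measure_display} {T : measurableType d}.
Variable P : probability T R.
Context {d' : measure_display} {T' : measurableType d'}.

Lemma measurable_indic_comp (X : T -> T') (B : set T') :
  measurable_fun setT X -> measurable B ->
  measurable_fun setT (fun w => \1_B (X w) : R).
Proof.
move=> mX mB; have mI : measurable_fun setT (\1_B : T' -> R).
  exact: measurable_indic.
exact: measurableT_comp mI mX.
Qed.

(** If the measure [B |-> E[H 1_B(X)]] is dominated by [c m] on measurable
    sets, then it is dominated for integrals of nonnegative functions; simple
    functions first, then monotone limits. *)
Lemma integral_weighted_nnsfun_le (m : {measure set T' -> \bar R})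
    (X : T -> T') (H : T -> R) (c : R) (h : {nnsfun T' >-> R}) :
  measurable_fun setT X -> measurable_fun setT H -> (forall w, 0 <= H w) ->
  (forall B, measurable B ->
    (\int[P]_w (H w * \1_B (X w))%:E <= c%:E * m B)%E) -> 0 <= c ->
  (\int[P]_w (H w * h (X w))%:E <= c%:E * \int[m]_x (h x)%:E)%E.
Proof.
move=> mX mH H0 HB c0.
rewrite integralT_nnsfun sintegralE ge0_mule_fsumr; last first.
  move=> r; have [r0|r0] := leP 0 r; first by rewrite mule_ge0.
  by rewrite preimage_nnfun0// measure0 mule0.
have -> : (\int[P]_w (H w * h (X w))%:E = \int[P]_w
    (\sum_(r \in range h) (r * (H w * \1_(h @^-1` [set r]) (X w)))%:E))%E.
  apply: eq_integral => w _; rewrite fimfunE fsbig_finite//= mulr_sumr.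
  rewrite fsbig_finite//= -sumEFin; apply: eq_bigr => r _.
  by rewrite mulrCA.
rewrite ge0_integral_fsum//; last 2 first.
- move=> r; apply/measurable_EFinP; apply: measurable_funM => //.
  apply: measurable_funM => //.
  exact: measurable_indic_comp.
- move=> r w _; rewrite lee_fin.
  have [r0|r0] := leP 0 r; first by rewrite mulr_ge0// mulr_ge0.
  by rewrite preimage_nnfun0// indic0 mulr0 mulr0.
apply: lee_fsum => // r _.
have [r0|r0] := leP 0 r; last first.
  rewrite preimage_nnfun0// measure0 mule0 mule0.
  under eq_integral do rewrite indic0 mulr0 mulr0.
  by rewrite integral0.
under eq_integral do rewrite EFinM.
rewrite ge0_integralZl_EFin//; last 2 first.
- by move=> w _; rewrite lee_fin mulr_ge0.
- apply/measurable_EFinP/measurable_funM => //.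
  exact: measurable_indic_comp.
rewrite muleCA lee_wpmul2l ?lee_fin//.
exact: HB.
Qed.

Lemma integral_weighted_le (m : {measure set T' -> \bar R})
    (X : T -> T') (H : T -> R) (c : R) (f : T' -> R) :
  measurable_fun setT X -> measurable_fun setT H -> (forall w, 0 <= H w) ->
  (forall B, measurable B ->
    (\int[P]_w (H w * \1_B (X w))%:E <= c%:E * m B)%E) -> 0 <= c ->
  measurable_fun setT f -> (forall x, 0 <= f x) ->
  (\int[P]_w (H w * f (X w))%:E <= c%:E * \int[m]_x (f x)%:E)%E.
Proof.
move=> mX mH H0 HB c0 mf f0.
have mEf : measurable_fun setT (EFin \o f) by exact/measurable_EFinP.
pose g := nnsfun_approx measurableT mEf.
have gf n x : (g n x <= f x).
  by rewrite -lee_fin /g nnsfun_approxE le_approx// => y _; rewrite lee_fin.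
have gcvg x : (EFin \o (fun n => g n x)) @ \oo --> (f x)%:E.
  by apply: cvg_nnsfun_approx => // y _; rewrite lee_fin.
have mHg n : measurable_fun setT (fun w => (H w * g n (X w))%:E).
  by apply/measurable_EFinP; apply: measurable_funM => //; exact: measurableT_comp.
have Hg0 n w : setT w -> (0 <= (H w * g n (X w))%:E)%E.
  by move=> _; rewrite lee_fin mulr_ge0.
have ndHg w : setT w ->
    {homo (fun n => (H w * g n (X w))%:E) : n k / (n <= k)%N >-> (n <= k)%E}.
  move=> _ n k nk; rewrite lee_fin ler_wpM2l//.
  exact/lefP/nd_nnsfun_approx.
have -> : (\int[P]_w (H w * f (X w))%:E =
    \int[P]_w limn (fun n => (H w * g n (X w))%:E))%E.
  apply: eq_integral => w _; apply/esym/cvg_lim => //.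
  have /(cvgeZl (isT : (H w)%:E \is a fin_num)) := gcvg (X w).
  by [].
rewrite monotone_convergence//.
apply: lime_le.
  apply: ereal_nondecreasing_is_cvgn => n k nk; apply: ge0_le_integral => //.
  - by move=> w _; apply: Hg0.
  - by move=> w _; apply: ndHg.
near=> n.
apply: (le_trans (integral_weighted_nnsfun_le (g n) mX mH H0 HB c0)).
rewrite lee_wpmul2l ?lee_fin//; apply: ge0_le_integral => //.
- by move=> x _; rewrite lee_fin.
- exact/measurable_EFinP.
- by move=> x _; rewrite lee_fin.
Unshelve. all: by end_near. Qed.

(** Independence is the case where every factor is an indicator.  The
    indicators are replaced by the functions [f i] one at a time; when the
    [k]-th one is replaced, the other factors form the weight [H] of
    [integral_weighted_le].  Working with upper bounds [M i] avoids products
    of infinite expectations. *)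
Lemma indep_prod_expectation_le n (X : 'I_n -> {RV P >-> T'})
    (f : 'I_n -> T' -> R) (M : 'I_n -> R) :
  mutually_independent X ->
  (forall i, measurable_fun setT (f i)) -> (forall i x, 0 <= f i x) ->
  (forall i, 0 <= M i) ->
  (forall i, (\int[P]_w (f i (X i w))%:E <= (M i)%:E)%E) ->
  (\int[P]_w (\prod_i f i (X i w))%:E <= (\prod_i M i)%:E)%E.
Proof.
move=> indep mf f0 M0 fM.
pose F k (B : 'I_n -> set T') (i : 'I_n) (x : T') : R :=
  if (i < k)%N then f i x else \1_(B i) x.
pose N k (B : 'I_n -> set T') (i : 'I_n) : R :=
  if (i < k)%N then M i else fine (P (X i @^-1` B i)).
have N0 k B i : 0 <= N k B i by rewrite /N; case: ifP => // _; exact: fine_ge0.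
have F0 k B i x : 0 <= F k B i x by rewrite /F; case: ifP.
have mF k B i : (forall i, measurable (B i)) -> measurable_fun setT (F k B i).
  move=> mB; rewrite /F; have [ik|ik] := ltnP i k; first exact: mf.
  exact: measurable_indic.
suff claim k : (k <= n)%N -> forall B, (forall i, measurable (B i)) ->
    (\int[P]_w (\prod_i F k B i (X i w))%:E <= (\prod_i N k B i)%:E)%E.
  have := claim n (leqnn n) (fun=> setT) (fun=> measurableT).
  under [in leRHS]eq_bigr do rewrite /N ltn_ord.
  by under eq_integral do under eq_bigr do rewrite /F ltn_ord.
elim: k => [_ B mB|k IH kn B mB].
  rewrite /F /N /=.
  have mA : measurable [set w | forall i, B i (X i w)].
    rewrite [X in measurable X](_ : _ = \bigcap_(i : 'I_n) (X i @^-1` B i)).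
      apply: fin_bigcap_measurable => // i _.
      by rewrite -[X in measurable X]setTI; exact: measurable_funP.
    by apply/seteqP; split => [w h i _|w h i]; exact: h.
  rewrite [leLHS](_ : _ = \int[P]_w (\1_[set w | forall i, B i (X i w)] w)%:E)%E.
    rewrite integral_indic// setIT.
    rewrite [leLHS](_ : _ = (\prod_(i < n) P (X i @^-1` B i))%E);
      last exact: indep B mB.
    rewrite [leLHS](_ : _ = (\prod_(i < n) fine (P (X i @^-1` B i)))%:E)//.
    elim/big_rec2 : _ => // i x y _ ->.
    by rewrite EFinM fineK// fin_num_measure// -[X in measurable X]setTI;
      exact: measurable_funP.
  apply: eq_integral => w _; congr EFin; rewrite indicE.
  have [/set_mem wA|/negP wA] := boolP (w \in _).
    by rewrite big1// => i _; rewrite indicE mem_set//; exact: wA.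
  have [i iB] : exists i, ~ B i (X i w).
    by apply/existsNP => h; apply: wA; rewrite inE.
  by rewrite (bigD1 i)//= indicE memNset// mul0r.
pose j := Ordinal kn.
have jE i : i != j -> (i < k.+1)%N = (i < k)%N.
  move=> ij; rewrite ltnS leq_eqVlt; case: eqP => // /= ik.
  by move/eqP: ij; case; apply: val_inj.
pose H w := \prod_(i | i != j) F k B i (X i w).
pose c := \prod_(i | i != j) N k B i.
have mXj i : measurable_fun setT (X i) by exact: measurable_funPT.
have mH : measurable_fun setT H.
  rewrite /H; under eq_fun do rewrite big_mkcond.
  apply: measurable_prod => i _; case: (i != j); last exact: measurable_cst.
  exact: (measurableT_comp (mF _ _ _ mB)).
have H0 w : 0 <= H w by exact: prodr_ge0.
have c0 : 0 <= c by exact: prodr_ge0.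
have Hc B' : measurable B' -> (\int[P]_w (H w * \1_B' (X j w))%:E <=
    c%:E * distribution P (X j) B')%E.
  move=> mB'.
  pose B2 i := if i == j then B' else B i.
  have mB2 i : measurable (B2 i) by rewrite /B2; case: ifP.
  have := IH (ltnW kn) B2 mB2.
  rewrite [in leRHS](bigD1 j)//= {1}/N /= ltnn /B2 eqxx EFinM muleC.
  rewrite fineK; last by rewrite fin_num_measure// -[X in measurable X]setTI;
      exact: mXj.
  rewrite (eq_bigr (N k B)); last by move=> i /negPf ij; rewrite /N ij.
  apply: le_trans; apply: ge0_le_integral => //.
  - by move=> w _; rewrite lee_fin mulr_ge0.
  - apply/measurable_EFinP/measurable_funM => //.
    exact: measurable_indic_comp.
  - apply/measurable_EFinP; apply: measurable_prod => i _.
    exact: (measurableT_comp (mF _ _ _ mB2)).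
  - move=> w _; rewrite lee_fin (bigD1 j)//= {1}/F ltnn eqxx mulrC ler_wpM2l//.
    by rewrite /H le_eqVlt; apply/orP; left; apply/eqP; apply: eq_bigr => i /negPf ij;
      rewrite /F ij.
rewrite [leLHS](_ : _ = \int[P]_w (H w * f j (X j w))%:E)%E; last first.
  apply: eq_integral => w _; congr EFin; rewrite (bigD1 j)//= {1}/F ltnSn mulrC.
  congr (_ * _); apply: eq_bigr => i ij; by rewrite /F jE.
apply: (le_trans (integral_weighted_le (mXj j) mH H0 Hc c0 (mf j) (f0 j))).
rewrite (bigD1 j)//= {1}/N ltnSn EFinM muleC.
rewrite (eq_bigr (N k B)); last by move=> i ij; rewrite /N jE.
rewrite lee_wpmul2r ?lee_fin//.
rewrite ge0_integral_distribution//; first exact: fM.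
  exact/measurable_EFinP.
by move=> x; rewrite lee_fin.
Qed.

End independence.

(** * Exponential moments of quadratic forms *)

Section exp_inequalities.
Context {R : realType}.
Implicit Types x y : R.

Lemma expRN_le_quad x : 0 <= x -> expR (- x) <= 1 - x + x ^+ 2.
Proof.
move=> x0; rewrite expRN; have e := expR_ge1Dx x.
have p : 0 < 1 + x by rewrite ltr_pwDl.
apply: (@le_trans _ _ (1 + x)^-1); first by rewrite lef_pV2// posrE ?expR_gt0.
by rewrite -div1r ler_pdivrMr//; nra.
Qed.

(** For centred variables the linear term integrates to zero, so an exponential
    moment of the square controls that of the variable itself. *)
Lemma expR_le_lin_sqr x : expR x <= x + expR (2 * x ^+ 2).
Proof.
have e := expR_ge1Dx (2 * x ^+ 2).
have [xle|xgt] := leP x 2^-1.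
  apply: (@le_trans _ _ (1 + x + 2 * x ^+ 2)); last by lra.
  have := expR_ge1Dx (- x); rewrite expRN => h.
  have p : 0 < 1 - x by lra.
  rewrite -(invrK (expR x)).
  apply: (@le_trans _ _ (1 - x)^-1).
    by rewrite lef_pV2// posrE invr_gt0 expR_gt0.
  by rewrite -div1r ler_pdivrMr//; have := sqr_ge0 x; nra.
rewrite -[leLHS]add0r lerD//; first by lra.
by rewrite ler_expR; nra.
Qed.

Lemma expR_convex0 (t y : R) : 0 <= t <= 1 ->
  expR (t * y) <= 1 - t + t * expR y.
Proof.
move=> /andP[t0 t1].
(* tangent lines of exp at t * y, evaluated at 0 and at y *)
have e1 := expR_ge1Dx (- (t * y)); have e2 := expR_ge1Dx (y - t * y).
have p := expR_gt0 (t * y).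
have h1 : (1 - t * y) * expR (t * y) <= 1.
  have := ler_wpM2r (ltW p) e1.
  by rewrite -expRD addNr expR0.
have h2 : (1 + (y - t * y)) * expR (t * y) <= expR y.
  have := ler_wpM2r (ltW p) e2.
  by rewrite -expRD subrK.
have h3 : 0 <= (1 - t) * (1 - (1 - t * y) * expR (t * y)).
  by rewrite mulr_ge0 ?subr_ge0.
have h4 : 0 <= t * (expR y - (1 + (y - t * y)) * expR (t * y)).
  by rewrite mulr_ge0 ?subr_ge0.
by lra.
Qed.

End exp_inequalities.

Section gaussian.
Context {R : realType}.
Let mu := @lebesgue_measure R.

(** Exponential tilting translates the Gaussian density. *)
Lemma normal_pdf01_expR (t x : R) :
  normal_pdf 0 1 x * expR (t * x) = expR (t ^+ 2 / 2) * normal_pdf t 1 x.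
Proof.
rewrite !normal_pdfE ?oner_neq0// /normal_fun mulrCA -mulrA -!expRD.
by congr (_ * expR _); field.
Qed.

(** The Hubbard-Stratonovich transform: [exp (a y^2)] is the moment generating
    function of a standard Gaussian variable at [sqrt (2 a) y]. *)
Lemma gaussian_linearization (a y : R) : 0 <= a ->
  (\int[mu]_x (normal_pdf 0 1 x * expR (Num.sqrt (2 * a) * y * x))%:E =
  (expR (a * y ^+ 2))%:E)%E.
Proof.
move=> a0; under eq_integral do rewrite normal_pdf01_expR EFinM.
rewrite ge0_integralZl_EFin//=; last 2 first.
- by move=> x _; rewrite lee_fin normal_pdf_ge0.
- by apply/measurable_EFinP; exact: measurable_normal_pdf.
rewrite integral_normal_pdf mule1 exprMn sqr_sqrtr ?mulr_ge0//.
by congr (expR _)%:E; field.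
Qed.

(** Completing the square turns the integrand into a Gaussian density of
    variance [1 / v], [v = 1 - 4 K a >= 1 / 2], times a constant.  That this
    constant is [1 + O(a)] at [s = 0] is essential: one such factor appears for every
    coordinate, and their product must be controlled by the sum of the
    coefficients. *)
Lemma gaussian_exp_quadratic (K a s : R) : 0 <= K -> 0 <= a -> 8 * K * a <= 1 ->
  (\int[mu]_x (normal_pdf 0 1 x * expR (K * (s + Num.sqrt (2 * a) * x) ^+ 2))%:E
  <= (expR (2 * K * s ^+ 2 + 4 * K * a))%:E)%E.
Proof.
move=> K0 a0 Ka; set b := Num.sqrt (2 * a).
have b2 : b ^+ 2 = 2 * a by rewrite sqr_sqrtr ?mulr_ge0.
pose v := 1 - 4 * K * a.
have Ka0 : 0 <= K * a by rewrite mulr_ge0.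
have v2 : 2^-1 <= v by rewrite /v; lra.
have v0 : 0 < v by rewrite (lt_le_trans _ v2).
pose sg := Num.sqrt v^-1; pose m := 2 * K * s * b / v.
have sg0 : 0 < sg by rewrite sqrtr_gt0 invr_gt0.
have sg2 : sg ^+ 2 = v^-1 by rewrite sqr_sqrtr// invr_ge0 ltW.
have peakE : normal_peak 1 = sg * normal_peak sg :> R.
  rewrite /normal_peak expr1n mul1r -mulrnAr sqrtrM ?sqr_ge0// sqrtr_sqr.
  by rewrite gtr0_norm// invfM mulrA divff ?gt_eqF// mul1r.
under eq_integral => x _.
  have -> : normal_pdf 0 1 x * expR (K * (s + b * x) ^+ 2) =
      sg * expR (K * s ^+ 2 / v) * normal_pdf m sg x.
    rewrite !normal_pdfE ?oner_neq0 ?gt_eqF// /normal_fun peakE.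
    rewrite -!mulrA; congr (_ * _); rewrite [in RHS]mulrCA; congr (_ * _).
    rewrite -!expRD; congr expR.
    rewrite sg2 /m expr1n subr0.
    have -> : K * (s + b * x) ^+ 2 =
       K * s ^+ 2 + 2 * K * s * b * x + K * b ^+ 2 * x ^+ 2 by ring.
    have vE : v = 1 - 2 * K * b ^+ 2 by rewrite /v b2; ring.
    move: v0; rewrite vE => v0; field.
    by rewrite gt_eqF//= gt_eqF.
  rewrite EFinM.
over.
rewrite ge0_integralZl_EFin//=; last 3 first.
- by move=> x _; rewrite lee_fin normal_pdf_ge0.
- by apply/measurable_EFinP; exact: measurable_normal_pdf.
- by rewrite mulr_ge0 ?expR_ge0// ltW.
rewrite integral_normal_pdf mule1 lee_fin addrC expRD.
apply: ler_pM; rewrite ?expR_ge0 ?(ltW sg0)//.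
- rewrite -(@ler_pXn2r _ 2) ?nnegrE ?expR_ge0 ?(ltW sg0)// sg2 -expRM_natl.
  have e := expR_ge1Dx (2 * (4 * K * a)).
  have p : 0 < 1 + 2 * (4 * K * a) by rewrite ltr_pwDl//; lra.
  apply: (le_trans _ e); rewrite -div1r ler_pdivrMr// /v.
  have : 0 <= K * a * (1 - 8 * K * a) by rewrite mulr_ge0// subr_ge0.
  by move: Ka0; lra.
- rewrite ler_expR ler_pdivrMr// -mulrA mulrAC -mulrA -[leLHS]mulr1.
  have h : 1 <= 2 * v by lra.
  have := ler_wpM2l (mulr_ge0 K0 (sqr_ge0 s)) h; lra.
Qed.

Context {d : measure_display} {T : measurableType d}.
Variable P : probability T R.

Lemma exp_square_of_exp_linear (H g : T -> R) (K a s M : R) :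
  measurable_fun setT H -> measurable_fun setT g -> (forall w, 0 <= H w) ->
  0 <= K -> 0 <= a -> 8 * K * a <= 1 -> 0 <= M ->
  (forall t, (\int[P]_w (H w * expR (t * g w))%:E <=
     (M * expR (K * (s + t) ^+ 2))%:E)%E) ->
  (\int[P]_w (H w * expR (a * g w ^+ 2))%:E <=
     (M * expR (2 * K * s ^+ 2 + 4 * K * a))%:E)%E.
Proof.
move=> mH mg H0 K0 a0 Ka M0 hyp; set b := Num.sqrt (2 * a).
pose F (z : T * R) := (H z.1 * (normal_pdf 0 1 z.2 * expR (b * g z.1 * z.2)))%:E.
have mF : measurable_fun setT F.
  apply/measurable_EFinP; apply: measurable_funM.
    exact: (measurableT_comp mH measurable_fst).
  apply: measurable_funM.
    exact: (measurableT_comp (measurable_normal_pdf _ _) measurable_snd).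
  apply: measurableT_comp => //; apply: measurable_funM => //.
  apply: measurable_funM => //; exact: (measurableT_comp mg measurable_fst).
have F0 z : (0 <= F z)%E.
  by rewrite lee_fin !mulr_ge0 ?normal_pdf_ge0 ?expR_ge0.
have -> : (\int[P]_w (H w * expR (a * g w ^+ 2))%:E =
    \int[P]_w \int[mu]_x F (w, x))%E.
  apply: eq_integral => w _; rewrite EFinM -gaussian_linearization//.
  rewrite -ge0_integralZl_EFin//.
  - by move=> x _; rewrite lee_fin mulr_ge0 ?normal_pdf_ge0 ?expR_ge0.
  - apply/measurable_EFinP; apply: measurable_funM.
      exact: measurable_normal_pdf.
    by apply: measurableT_comp => //; exact: measurable_funM.
rewrite fubini_tonelli//.
apply: (@le_trans _ _ (\int[mu]_x (M%:E *
    (normal_pdf 0 1 x * expR (K * (s + b * x) ^+ 2))%:E))%E).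
  apply: ge0_le_integral => //.
  - by move=> x _; exact: integral_ge0.
  - exact: measurable_fun_fubini_tonelli_G.
  - apply/measurable_EFinP/measurable_funM => //; apply: measurable_funM => //.
      exact: measurable_normal_pdf.
    apply: measurableT_comp => //; apply: measurable_funM => //.
    by apply: measurable_funX; apply: measurable_funD => //; exact: measurable_funM.
  - move=> x _; rewrite /F /=.
    under eq_integral => w _.
      rewrite mulrCA EFinM (mulrAC b) .
    over.
    rewrite ge0_integralZl_EFin//; last 3 first.
    - by move=> w _; rewrite lee_fin mulr_ge0 ?expR_ge0.
    - apply/measurable_EFinP/measurable_funM => //.
      by apply: measurableT_comp => //; exact: measurable_funM.
    - exact: normal_pdf_ge0.
    rewrite -EFinM mulrCA EFinM lee_wpmul2l ?lee_fin ?normal_pdf_ge0//.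
rewrite ge0_integralZl_EFin//; last 2 first.
- by move=> x _; rewrite lee_fin mulr_ge0 ?normal_pdf_ge0 ?expR_ge0.
- apply/measurable_EFinP/measurable_funM; first exact: measurable_normal_pdf.
  apply: measurableT_comp => //; apply: measurable_funM => //.
  by apply: measurable_funX; apply: measurable_funD => //; exact: measurable_funM.
by rewrite EFinM lee_wpmul2l ?lee_fin//; exact: gaussian_exp_quadratic.
Qed.

End gaussian.

Section quadratic_forms.
Context {R : realType} {d : measure_display} {T : measurableType d}.
Variable P : probability T R.

(** The squares are linearised one coordinate at a time: a treated coordinate
    doubles its share of the linear form and costs [exp (4 K a_j)].  Only
    the sum of the coefficients, not their number, enters the bound. *)
Lemma exp_quadratic_form_le p (g : 'I_p -> T -> R) (K : R) (a : 'I_p -> R) :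
  (forall j, measurable_fun setT (g j)) -> 0 <= K ->
  (forall j, 0 <= a j) -> (forall j, 8 * K * a j <= 1) ->
  (forall s : 'I_p -> R, (\int[P]_w (expR (\sum_j s j * g j w))%:E <=
     (expR (K * \sum_j s j ^+ 2))%:E)%E) ->
  (\int[P]_w (expR (\sum_j a j * g j w ^+ 2))%:E <=
     (expR (4 * K * \sum_j a j))%:E)%E.
Proof.
move=> mg K0 a0 Ka hyp.
suff claim (r : seq 'I_p) : uniq r -> forall s : 'I_p -> R,
    (\int[P]_w (expR (\sum_j s j * g j w + \sum_(j <- r) a j * g j w ^+ 2))%:E
     <= (expR (K * \sum_j (1 + (j \in r)%:R) * s j ^+ 2 +
           4 * K * \sum_(j <- r) a j))%:E)%E.
  have := claim (index_enum 'I_p) (index_enum_uniq _) (fun=> 0).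
  rewrite [X in K * X]big1 ?mulr0 ?add0r; last by move=> j _; rewrite expr0n mulr0.
  apply: le_trans; rewrite le_eqVlt; apply/orP; left; apply/eqP.
  apply: eq_integral => w _; rewrite [X in _ = (expR (X + _))%:E]big1 ?add0r//.
  by move=> j _; rewrite mul0r.
elim: r => [_ s|j0 r IH].
  rewrite big_nil mulr0 addr0; under eq_integral do rewrite big_nil addr0.
  by under [X in K * X]eq_bigr do rewrite in_nil addr0 mul1r.
move=> /= /andP[j0r ur] s.
pose M := expR (K * (\sum_(j | j != j0) (1 + (j \in r)%:R) * s j ^+ 2) +
           4 * K * \sum_(j <- r) a j).
have mlin (s' : 'I_p -> R) : measurable_fun setT (fun w => \sum_j s' j * g j w).
  by apply: measurable_sum => j; exact: measurable_funM.
have mquad : measurable_fun setT (fun w => \sum_(j <- r) a j * g j w ^+ 2).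
  apply: measurable_sum => j; apply: measurable_funM => //.
  exact: measurable_funX.
have := @exp_square_of_exp_linear R d T P
  (fun w => expR (\sum_j s j * g j w + \sum_(j <- r) a j * g j w ^+ 2))
  (g j0) K (a j0) (s j0) M.
rewrite -expRD.
have -> : K * (\sum_(j | j != j0) (1 + (j \in r)%:R) * s j ^+ 2) +
    4 * K * (\sum_(j <- r) a j) + (2 * K * s j0 ^+ 2 + 4 * K * a j0) =
    K * (\sum_j (1 + (j \in j0 :: r)%:R) * s j ^+ 2) +
      4 * K * (\sum_(j <- j0 :: r) a j).
  rewrite big_cons [in RHS](bigD1 j0)//= mem_head.
  rewrite [in RHS](eq_bigr (fun j => (1 + (j \in r)%:R) * s j ^+ 2)); last first.
    by move=> j /negPf jj0; rewrite in_cons jj0.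
  rewrite -[true%:R]/(1 : R); set S := \sum_(j < p | _) _; ring.
rewrite (_ : (fun w => _) = (fun w => (expR (\sum_j s j * g j w +
    \sum_(j <- j0 :: r) a j * g j w ^+ 2))%:E)); last first.
  by apply/funext => w; rewrite -expRD big_cons; congr (expR _)%:E; ring.
apply => //.
- apply: measurableT_comp => //; exact: measurable_funD.
- by rewrite expR_ge0.
move=> t; pose s' j := if j == j0 then s j + t else s j.
have := IH ur s'.
rewrite /M -expRD.
have -> : K * (\sum_j (1 + (j \in r)%:R) * s' j ^+ 2) + 4 * K * (\sum_(j <- r) a j) =
    K * (\sum_(j | j != j0) (1 + (j \in r)%:R) * s j ^+ 2) +
      4 * K * (\sum_(j <- r) a j) + K * (s j0 + t) ^+ 2.
  rewrite (bigD1 j0)//= /s' eqxx (negPf j0r).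
  rewrite (eq_bigr (fun j => (1 + (j \in r)%:R) * s j ^+ 2)); last first.
    by move=> j /negPf jj0; rewrite jj0.
  rewrite -[false%:R]/(0 : R); set S := \sum_(j < p | _) _; ring.
apply: le_trans; rewrite le_eqVlt; apply/orP; left; apply/eqP.
apply: eq_integral => w _; rewrite -expRD; congr (expR _)%:E.
rewrite [in RHS](bigD1 j0)//= [in LHS](bigD1 j0)//= /s' eqxx.
rewrite [in RHS](eq_bigr (fun j => s j * g j w)); last first.
  by move=> j /negPf jj0; rewrite jj0.
ring.
Qed.

End quadratic_forms.

(** * Nets of the unit ball *)

Section nets.
Context {R : realType}.

Definition is_net N (e : R) (G : seq 'cV[R]_N) :=
  forall u : 'cV[R]_N, nsq u <= 1 ->
    exists v, [/\ v \in G, nsq v <= 1 & nsq (u - v) <= e].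

Lemma geometric_half_le2 L : \sum_(k < L) (2^-1 : R) ^+ k <= 2.
Proof.
have -> : \sum_(k < L) (2^-1 : R) ^+ k = 2 - 2 * 2^-1 ^+ L.
  elim: L => [|L IH]; first by rewrite big_ord0 expr0; ring.
  by rewrite big_ord_recr /= IH exprS; field.
by rewrite gerBl mulr_ge0// exprn_ge0// invr_ge0.
Qed.

(** Every counted [f] contributes at least 1 to the sum of
    [2^(K - sum_i (f i).2)], which factors over the coordinates. *)
Lemma card_bounded_sum_le N L K :
  (#|[set f : {ffun 'I_N -> bool * 'I_L} | (\sum_i (f i).2 <= K)%N]%SET|%:R : R)
  <= 2 ^+ K * 4 ^+ N.
Proof.
set F := [set _ | _]%SET.
have h2 : 0 < (2^-1 : R) by rewrite invr_gt0.
have le4 : \sum_(f : {ffun 'I_N -> bool * 'I_L}) \prod_i (2^-1 : R) ^+ (f i).2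
    <= 4 ^+ N.
  rewrite -(bigA_distr_bigA (fun=> fun x : bool * 'I_L => (2^-1 : R) ^+ x.2)).
  rewrite prodr_const card_ord; apply: lerXn2r; rewrite ?nnegrE//.
    by apply: sumr_ge0 => x _; rewrite exprn_ge0// ltW.
  rewrite -(pair_bigA _ (fun (b : bool) (k : 'I_L) => (2^-1 : R) ^+ k)) /=.
  rewrite sumr_const card_bool; have := geometric_half_le2 L; lra.
apply: (le_trans _ (ler_wpM2l (exprn_ge0 K (ler0n _ 2)) le4)).
rewrite -sum1_card natr_sum mulr_sumr big_mkcond; apply: ler_sum => f _.
rewrite prodrXr; case: ifPn => [|_]; last first.
  by rewrite mulr_ge0// exprn_ge0// ltW.
rewrite inE => fK; rewrite exprVn ler_pdivlMr ?exprn_gt0// mul1r.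
by rewrite ler_eXn2l// ltr1n.
Qed.

(** Round the coordinates towards zero to multiples of [h = 1 / (r sqrt N)].
    The errors are at most [h], and the absolute values [k_i] of the rounded
    integers satisfy [sum k_i <= sum k_i^2 <= r^2 N], which leaves only
    exponentially many possibilities. *)
Lemma exists_net N r : (0 < r)%N ->
  exists G : seq 'cV[R]_N, is_net ((r ^ 2)%:R^-1) G /\
    (size G)%:R <= ((4 * 2 ^+ (r ^ 2)) ^+ N : R).
Proof.
move=> r0; pose h : R := (r%:R * Num.sqrt N%:R)^-1.
pose L := (r * N).+1.
pose pt (f : {ffun 'I_N -> bool * 'I_L}) : 'cV[R]_N :=
  \col_i ((-1) ^+ (f i).1 * ((f i).2%:R * h)).
pose F := [set f : {ffun 'I_N -> bool * 'I_L} |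
  (\sum_i (f i).2 <= r ^ 2 * N)%N]%SET.
exists [seq pt f | f in F]; split; last first.
  rewrite size_map -cardE (le_trans (card_bounded_sum_le _ _ _))//.
  by rewrite exprMn mulrC -exprM.
move=> u u1.
have [N0|N0] := posnP N.
  exists (pt [ffun=> (false, ord0)]); split.
  - apply: map_f; rewrite mem_enum inE big1// => i _; by rewrite ffunE.
  - rewrite /nsq big1// => i _; by have := ltn_ord i; rewrite {2}N0.
  - rewrite /nsq big1 ?invr_ge0// => i _; by have := ltn_ord i; rewrite {2}N0.
have NR : 0 < N%:R :> R by rewrite ltr0n.
have rR : 0 < r%:R :> R by rewrite ltr0n.
have h0 : 0 < h by rewrite invr_gt0 mulr_gt0 ?sqrtr_gt0.
have h2 : h ^+ 2 * N%:R = (r ^ 2)%:R^-1.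
  rewrite /h exprVn exprMn sqr_sqrtr ?ler0n// natrX; field.
  by rewrite !gt_eqF.
have ui i : u i 0 ^+ 2 <= 1.
  apply: le_trans u1; rewrite /nsq (bigD1 i)//= lerDl.
  by apply: sumr_ge0 => k _; exact: sqr_ge0.
pose k i := Num.truncn (`|u i 0| / h).
have kle i : (k i)%:R * h <= `|u i 0|.
  by rewrite -ler_pdivlMr// truncn_le// divr_ge0// ltW.
have kgt i : `|u i 0| - (k i)%:R * h <= h.
  have : `|u i 0| / h < (k i).+1%:R by apply: truncnS_gt; rewrite divr_ge0// ltW.
  by rewrite ltr_pdivrMr// -natr1 mulrDl mul1r; lra.
have kL i : (k i < L)%N.
  rewrite ltnS -(ler_nat R) natrM.
  have : (k i)%:R * h <= 1.
    apply: (le_trans (kle i)); rewrite -(@ler_pXn2r _ 2) ?nnegrE//.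
    by rewrite real_normK ?num_real// expr1n.
  rewrite -ler_pdivlMr// div1r invrK => /le_trans; apply.
  rewrite ler_pM2l// -(@ler_pXn2r _ 2) ?nnegrE// ?sqrtr_ge0 ?(ltW NR)//.
  by rewrite sqr_sqrtr ?(ltW NR)// expr2 ler_peMl ?(ltW NR)// ler1n.
pose f := [ffun i => (u i 0 < 0, Ordinal (kL i))].
have ptE i : u i 0 = (-1) ^+ (u i 0 < 0)%R * `|u i 0| by exact: realEsign (num_real _).
have ptf i : pt f i 0 = (-1) ^+ (u i 0 < 0)%R * ((k i)%:R * h).
  by rewrite mxE ffunE.
exists (pt f); split.
- apply: map_f; rewrite mem_enum inE -(ler_nat R).
  under eq_bigr do rewrite ffunE /=.
  rewrite natr_sum natrM.
  apply: (@le_trans _ _ (\sum_i (u i 0 ^+ 2 / h ^+ 2))).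
    apply: ler_sum => i _; apply: (@le_trans _ _ ((k i)%:R ^+ 2)).
      by rewrite -natrX ler_nat; case: (k i) => // n; rewrite expnS expn1 leq_pmulr.
    rewrite ler_pdivlMr ?exprn_gt0// -exprMn -(real_normK (num_real (u i 0))).
    by rewrite ler_pXn2r ?nnegrE// mulr_ge0 ?(ltW h0).
  rewrite -mulr_suml ler_pdivrMr ?exprn_gt0// (le_trans u1)//.
  rewrite -mulrA (mulrC N%:R) h2 mulfV// natrX gt_eqF// exprn_gt0//.
- apply: le_trans u1; apply: ler_sum => i _.
  rewrite ptf -[leRHS](real_normK (num_real (u i 0))) exprMn sqrr_sign mul1r.
  rewrite ler_pXn2r ?nnegrE//.
  by rewrite mulr_ge0 ?(ltW h0).
- rewrite -h2 mulr_natr -[leRHS](_ : \sum_(i < N) h ^+ 2 = _); last first.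
    by rewrite sumr_const card_ord.
  apply: ler_sum => i _; rewrite [(_ - _ : 'cV[R]_N) i 0]mxE [(- _ : 'cV[R]_N) i 0]mxE.
  rewrite ptf {1}ptE -mulrBr exprMn sqrr_sign mul1r.
  by rewrite ler_pXn2r ?nnegrE ?subr_ge0 ?(ltW h0).
Qed.

Lemma nsq0 m : nsq (0 : 'cV[R]_m) = 0.
Proof. by rewrite /nsq big1// => i _; rewrite mxE expr0n. Qed.

Lemma nsq_normalize N (u : 'cV[R]_N) : nsq u != 0 ->
  exists2 k : R, k ^+ 2 = (nsq u)^-1 & nsq (k *: u) = 1.
Proof.
move=> u0; have up : 0 < nsq u by rewrite lt_neqAle eq_sym u0 nsq_ge0.
have k2 : (Num.sqrt (nsq u))^-1 ^+ 2 = (nsq u)^-1.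
  by rewrite exprVn sqr_sqrtr ?ltW.
by exists (Num.sqrt (nsq u))^-1; rewrite ?nsqZ k2 ?mulVf.
Qed.

Lemma nsq_homogeneous_ext m N (M : 'M[R]_(m, N)) (C : R) :
  (forall u, nsq u = 1 -> nsq (M *m u) <= C) ->
  forall u, nsq (M *m u) <= C * nsq u.
Proof.
move=> H u; have [u0|u0] := eqVneq (nsq u) 0.
  have -> : u = 0 by apply: nsq_eq0; rewrite u0.
  by rewrite mulmx0 !nsq0 mulr0.
have up : 0 < nsq u by rewrite lt_neqAle eq_sym u0 nsq_ge0.
have [k k2 k1] := nsq_normalize u0.
by have := H _ k1; rewrite -scalemxAr nsqZ k2 ler_pdivrMl// mulrC.
Qed.

Lemma nsq_mulmx_bounded m N (M : 'M[R]_(m, N)) :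
  exists C, forall u, nsq u <= 1 -> nsq (M *m u) <= C.
Proof.
exists (\sum_i (\sum_j `|M i j|) ^+ 2) => u u1.
apply: ler_sum => i _; rewrite -(real_normK (num_real _)) ler_pXn2r ?nnegrE//.
  by rewrite mxE (le_trans (ler_norm_sum _ _ _))//; apply: ler_sum => j _;
  rewrite normrM ler_piMr// -(@ler_pXn2r _ 2) ?nnegrE// real_normK ?num_real//
    expr1n (le_trans _ u1)// /nsq (bigD1 j)//= lerDl; apply: sumr_ge0 => k _;
  exact: sqr_ge0.
by apply: sumr_ge0.
Qed.

(** The supremum [S] of [|M u|^2] over the unit ball bounds itself:
    approximating [u] by the net gives [S <= 2 B + S / 2]. *)
Lemma net_upper m N (M : 'M[R]_(m, N)) (e B : R) (G : seq 'cV[R]_N) :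
  e <= 4^-1 -> is_net e G ->
  (forall v, v \in G -> nsq v <= 1 -> nsq (M *m v) <= B) ->
  forall u, nsq (M *m u) <= 4 * B * nsq u.
Proof.
move=> e4 netG HB.
pose S := [set nsq (M *m u) | u in [set u | nsq u <= 1]].
have supS : has_sup S.
  split; first by exists (nsq (M *m 0)); exists 0 => //=; rewrite nsq0.
  by have [C HC] := nsq_mulmx_bounded M; exists C => _ [u u1 <-]; exact: HC.
have leS u : nsq u <= 1 -> nsq (M *m u) <= sup S.
  by move=> u1; apply: ub_le_sup; [exact: supS.2|exists u].
have S4 : sup S <= 4 * B.
  have : sup S <= 2 * B + sup S / 2.
    apply: ge_sup; first exact: supS.1.
    move=> _ [u u1 <-]; have [v [vG v1 uv]] := netG u u1.
    have -> : M *m u = M *m v + M *m (u - v).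
      by rewrite -mulmxDr addrC subrK.
    rewrite (le_trans (nsqD_le _ _))// lerD//; first by rewrite ler_pM2l// HB.
    have := leS (2 *: (u - v)); rewrite -scalemxAr !nsqZ => h.
    have : 2 ^+ 2 * nsq (M *m (u - v)) <= sup S by apply: h; lra.
    lra.
  lra.
apply: nsq_homogeneous_ext => u u1; apply: le_trans S4.
by apply: leS; rewrite u1.
Qed.

(** At a unit vector the error of the approximation is at most [C e], which is
    negligible compared with the lower bound [b] on the net. *)
Lemma net_lower m N (M : 'M[R]_(m, N)) (e C b : R) (G : seq 'cV[R]_N) :
  e <= 4^-1 -> C * e <= b / 16 -> 0 <= b -> 0 <= C -> is_net e G ->
  (forall u, nsq (M *m u) <= C * nsq u) ->
  (forall v, v \in G -> b * nsq v <= nsq (M *m v)) ->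
  forall u, b / 16 * nsq u <= nsq (M *m u).
Proof.
move=> e4 Ce b0 C0 netG HC Hb.
suff H u : nsq u = 1 -> b / 16 <= nsq (M *m u).
  move=> u; have [u0|u0] := eqVneq (nsq u) 0.
    by rewrite u0 mulr0 nsq_ge0.
  have up : 0 < nsq u by rewrite lt_neqAle eq_sym u0 nsq_ge0.
  have [k k2 k1] := nsq_normalize u0.
  by have := H _ k1; rewrite -scalemxAr nsqZ k2 ler_pdivlMl// mulrC.
move=> u1; have ule1 : nsq u <= 1 by rewrite u1.
have [v [vG v1 uv]] := netG u ule1.
have h1 := Hb v vG.
have h2 : nsq (M *m v) <= 2 * nsq (M *m u) + 2 * (C * e).
  have -> : M *m v = M *m u + (- 1) *: (M *m (u - v)).
    by rewrite scaleN1r -mulmxN -mulmxDr opprB addrC subrK.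
  rewrite (le_trans (nsqD_le _ _))// lerD2l ler_pM2l// nsqZ sqrrN expr1n mul1r.
  by rewrite (le_trans (HC _))// ler_wpM2l.
have h3 : 1 <= 2 * nsq v + 2 * e.
  have := nsqD_le v (u - v); rewrite (addrC v) subrK u1; lra.
have h4 : b * 4^-1 <= b * nsq v by rewrite ler_wpM2l//; lra.
lra.
Qed.

End nets.

(** * Sub-Gaussian random variables *)

Section scalar_subgaussian.
Context {R : realType} {d : measure_display} {T : measurableType d}.
Variable P : probability T R.

Lemma measurable_lt_set (f h : T -> R) :
  measurable_fun setT f -> measurable_fun setT h ->
  measurable [set w | f w < h w].
Proof.
move=> mf mh.
have : measurable (setT `&` (fun w => f w < h w) @^-1` [set true]).
  exact: (measurable_fun_ltr mf mh).
by rewrite setTI preimage_true.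
Qed.

Lemma measurable_le_set (f h : T -> R) :
  measurable_fun setT f -> measurable_fun setT h ->
  measurable [set w | f w <= h w].
Proof.
move=> mf mh.
have : measurable (setT `&` (fun w => f w <= h w) @^-1` [set true]).
  exact: (measurable_fun_ler mf mh).
by rewrite setTI preimage_true.
Qed.

Lemma le_integral_nonneg (f h : T -> R) :
  measurable_fun setT f -> measurable_fun setT h ->
  (forall w, 0 <= f w) -> (forall w, f w <= h w) ->
  (\int[P]_w (f w)%:E <= \int[P]_w (h w)%:E)%E.
Proof.
move=> mf mh f0 fh; apply: ge0_le_integral => //.
- by move=> w _; rewrite lee_fin.
- exact/measurable_EFinP.
- exact/measurable_EFinP.
- by move=> w _; rewrite lee_fin.
Qed.

Lemma integral_cst_prob (c : R) : (\int[P]_w c%:E = c%:E)%E.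
Proof.
rewrite -[RHS]mule1 -(@probability_setT _ _ _ P) -integral_cst//.
Qed.

Lemma integral_affine (a b : R) (f : T -> R) :
  measurable_fun setT f -> (forall w, 0 <= f w) -> 0 <= a -> 0 <= b ->
  (\int[P]_w (a + b * f w)%:E = a%:E + b%:E * \int[P]_w (f w)%:E)%E.
Proof.
move=> mf f0 a0 b0; under eq_integral do rewrite EFinD.
rewrite ge0_integralD//; last 2 first.
- by move=> w _; rewrite lee_fin mulr_ge0.
- by apply/measurable_EFinP; exact: measurable_funM.
rewrite integral_cst_prob; congr (_ + _)%E.
under eq_integral do rewrite EFinM.
rewrite ge0_integralZl_EFin//; last exact/measurable_EFinP.
by move=> w _; rewrite lee_fin.
Qed.

Variables (g : T -> R) (v : R).
Hypotheses (mg : measurable_fun setT g) (v0 : 0 < v).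
Hypothesis psi2 : (\int[P]_w (expR (g w ^+ 2 / v))%:E <= 2%:E)%E.

Let mE : measurable_fun setT (fun w => expR (g w ^+ 2 / v)).
Proof.
apply: measurableT_comp => //; apply: measurable_funM => //.
exact: measurable_funX.
Qed.

(** For [v <= 1 / 2] the constant term must not exceed [1 + O(v)]: the linear
    term vanishes by centring, and convexity gives
    [E exp (2 g^2) <= 1 + 2 v].  For larger [v] the crude bound
    [g <= v / 4 + g^2 / v] is enough. *)
Lemma subgaussian_mgf_le : P.-integrable setT (EFin \o g) ->
  (\int[P]_w (g w)%:E = 0)%E ->
  (\int[P]_w (expR (g w))%:E <= (expR (3 * v))%:E)%E.
Proof.
move=> ig g0; have [vsmall|vlarge] := leP (2 * v) 1.
  pose h w := 1 - 2 * v + 2 * v * expR (g w ^+ 2 / v).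
  have v2 : 0 <= 1 - 2 * v by rewrite subr_ge0.
  have hle w : expR (g w) <= g w + h w.
    rewrite (le_trans (expR_le_lin_sqr _))// lerD2l /h.
    have -> : 2 * g w ^+ 2 = 2 * v * (g w ^+ 2 / v) by field; rewrite gt_eqF.
    by apply: expR_convex0; rewrite vsmall mulr_ge0// ltW.
  have mh : measurable_fun setT h.
    by apply: measurable_funD => //; exact: measurable_funM.
  have inth : (\int[P]_w (h w)%:E <= (1 + 2 * v)%:E)%E.
    rewrite integral_affine// ?mulr_ge0 ?(ltW v0)//.
    apply: (@le_trans _ _ ((1 - 2 * v)%:E + (2 * v)%:E * 2%:E)%E).
      by rewrite leeD2l// lee_wpmul2l ?lee_fin// mulr_ge0// ltW.
    by rewrite -EFinM -EFinD lee_fin; lra.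
  have h0 w : 0 <= h w.
    by rewrite addr_ge0// mulr_ge0 ?expR_ge0// mulr_ge0// ltW.
  have ih : P.-integrable setT (EFin \o h).
    apply/integrableP; split; first exact/measurable_EFinP.
    under eq_integral do rewrite /= ger0_norm//.
    by apply: (le_lt_trans inth); rewrite ltry.
  apply: (@le_trans _ _ (\int[P]_w (g w + h w)%:E)%E).
    apply: le_integral_nonneg => [| |w|//].
    - exact: measurableT_comp.
    - exact: measurable_funD.
    - by rewrite expR_ge0.
  under eq_integral do rewrite EFinD.
  rewrite integralD// g0 add0e (le_trans inth)// lee_fin.
  have := expR_ge1Dx (3 * v); move: v0; lra.
apply: (@le_trans _ _
    (\int[P]_w (0 + expR (v / 4) * expR (g w ^+ 2 / v))%:E)%E).
  apply: le_integral_nonneg => [| |w|w].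
  - exact: measurableT_comp.
  - by apply: measurable_funD => //; exact: measurable_funM.
  - by rewrite expR_ge0.
  - rewrite add0r -expRD ler_expR -subr_ge0.
    have -> : v / 4 + g w ^+ 2 / v - g w = (g w - v / 2) ^+ 2 / v.
      by field; rewrite gt_eqF.
    by rewrite divr_ge0 ?sqr_ge0// ltW.
rewrite integral_affine ?expR_ge0// add0e.
apply: (@le_trans _ _ ((expR (v / 4))%:E * 2%:E)%E).
  by rewrite lee_wpmul2l ?lee_fin ?expR_ge0.
rewrite -EFinM lee_fin (_ : 3 * v = v / 4 + (3 - 4^-1) * v); last by field.
rewrite expRD ler_wpM2l ?expR_ge0//.
have := expR_ge1Dx ((3 - 4^-1) * v); move: vlarge; lra.
Qed.

(** From [exp (- y) <= 1 - y + y^2]: the second moment gives the linear gain and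
    the fourth moment, bounded through [psi2], a loss that is half as large
    for the chosen scale. *)
Lemma subgaussian_small_ball :
  (\int[P]_w (g w ^+ 2)%:E = 1)%E ->
  (\int[P]_w (expR (- (g w ^+ 2 / (16 * v ^+ 2))))%:E <=
    (expR (- (32 * v ^+ 2)^-1))%:E)%E.
Proof.
move=> g1; pose t := (16 * v ^+ 2)^-1.
have t0 : 0 < t by rewrite invr_gt0 mulr_gt0// exprn_gt0.
have mg2 : measurable_fun setT (fun w => g w ^+ 2) by exact: measurable_funX.
have mexp : measurable_fun setT (fun w => expR (- (g w ^+ 2 / (16 * v ^+ 2)))).
  apply: measurableT_comp => //; apply: measurableT_comp => //.
  exact: measurable_funM.
have key : (\int[P]_w (expR (- (g w ^+ 2 / (16 * v ^+ 2))) + t * g w ^+ 2)%:E <=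
    \int[P]_w (1 + (4 * v ^+ 2 * t ^+ 2) * expR (g w ^+ 2 / v))%:E)%E.
  apply: le_integral_nonneg.
  - by apply: measurable_funD => //; exact: measurable_funM.
  - by apply: measurable_funD => //; exact: measurable_funM.
  - by move=> w; rewrite addr_ge0 ?expR_ge0// mulr_ge0 ?sqr_ge0// ltW.
  - move=> w; rewrite -/t; set y := g w ^+ 2.
    have y0 : 0 <= y by exact: sqr_ge0.
    have := expRN_le_quad (mulr_ge0 y0 (ltW t0)).
    have yv0 : 0 <= y / v by rewrite divr_ge0// ltW.
    have h : (y / v) ^+ 2 <= 4 * expR (y / v).
      have -> : y / v = 2%:R * (y / v / 2) by field; rewrite gt_eqF.
      rewrite expRM_natl exprMn -natrX ler_pM2l// ler_pXn2r ?nnegrE ?expR_ge0//.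
        by rewrite (le_trans _ (expR_ge1Dx _))// lerDr.
      by rewrite divr_ge0.
    have : v ^+ 2 * t ^+ 2 * ((y / v) ^+ 2) <= v ^+ 2 * t ^+ 2 * (4 * expR (y / v)).
      by rewrite ler_wpM2l// mulr_ge0 ?sqr_ge0.
    have -> : v ^+ 2 * t ^+ 2 * ((y / v) ^+ 2) = (y * t) ^+ 2.
      by field; rewrite gt_eqF.
    lra.
move: key; rewrite integral_affine//; last by rewrite mulr_ge0 ?sqr_ge0// mulr_ge0 ?sqr_ge0.
under eq_integral do rewrite EFinD EFinM.
rewrite ge0_integralD//; last 3 first.
- exact/measurable_EFinP.
- by move=> w _; rewrite -EFinM lee_fin mulr_ge0 ?sqr_ge0// ltW.
- by apply/measurable_EFinP; exact: measurable_funM.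
rewrite ge0_integralZl_EFin// ?(ltW t0)//; last 2 first.
- by move=> w _; rewrite lee_fin sqr_ge0.
- exact/measurable_EFinP.
rewrite g1 mule1 => key.
rewrite -(@leeD2rE _ t%:E)//.
apply: (le_trans key); apply: (@le_trans _ _ (1%:E + (4 * v ^+ 2 * t ^+ 2)%:E * 2%:E)%E).
  by rewrite leeD2l// lee_wpmul2l// lee_fin mulr_ge0 ?sqr_ge0// mulr_ge0 ?sqr_ge0.
rewrite -EFinM -!EFinD lee_fin.
have -> : 4 * v ^+ 2 * t ^+ 2 * 2 = t / 2 by rewrite /t; field; rewrite gt_eqF.
have -> : (32 * v ^+ 2)^-1 = t / 2 by rewrite /t; field; rewrite gt_eqF.
have := expR_ge1Dx (- (t / 2)); lra.
Qed.

Lemma chernoff_le (Y : T -> R) (C y : R) : measurable_fun setT Y ->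
  (\int[P]_w (expR (Y w))%:E <= C%:E)%E ->
  (P [set w | y < Y w]%R <= (C * expR (- y))%:E)%E.
Proof.
move=> mY HC; set A := [set w | _].
have mA : measurable A.
  exact: measurable_lt_set.
have : ((expR y)%:E * P A <= \int[P]_w (expR (Y w))%:E)%E.
  rewrite -{1}(setIT A) -(integral_indic _ measurableT mA).
  rewrite -ge0_integralZl_EFin ?expR_ge0//; last first.
    by apply/measurable_EFinP; exact: measurable_indic.
  under eq_integral do rewrite -EFinM.
  apply: le_integral_nonneg => [| |w|w].
  - by apply: measurable_funM => //; exact: measurable_indic.
  - exact: measurableT_comp.
  - by rewrite mulr_ge0 ?expR_ge0.
  - rewrite indicE; have [/set_mem wA|_] := boolP (w \in A).
      by rewrite mulr1 ler_expR ltW.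
    by rewrite mulr0 expR_ge0.
move=> /le_trans /(_ HC) h.
rewrite -(@lee_pmul2l _ (expR y)%:E) ?lte_fin ?expR_gt0//.
by rewrite (le_trans h)// -EFinM mulrCA -expRD subrr expR0 mulr1.
Qed.

End scalar_subgaussian.

(** * Whitened sub-Gaussian vectors *)

Section psi2.
Context {R : realType} {d : measure_display} {T : measurableType d}.
Variable P : probability T R.

Lemma expectationE (f : T -> R) : ('E_P[f] = \int[P]_w (f w)%:E)%E.
Proof. by rewrite unlock. Qed.

(** The infimum defining the norm need not be attained, so the bound is stated
    at any [tau > sigma]. *)
Lemma psi2_vnorm_exp_le p (z : T -> 'rV[R]_p) (sigma tau : R) (s : 'I_p -> R) :
  (forall j, measurable_fun setT (fun w => z w 0 j)) ->
  (psi2_vnorm P z <= sigma%:E)%E -> sigma < tau -> \sum_j s j ^+ 2 <= 1 ->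
  (\int[P]_w (expR ((\sum_j s j * z w 0 j) ^+ 2 / tau ^+ 2))%:E <= 2%:E)%E.
Proof.
move=> mz hz st s1; pose s' : 'rV[R]_p := \row_j s j.
have dotE w : dotrv s' (z w) = \sum_j s j * z w 0 j.
  by apply: eq_bigr => j _; rewrite mxE.
have mdot : measurable_fun setT (fun w => \sum_j s j * z w 0 j).
  by apply: measurable_sum => j; exact: measurable_funM.
have [s0|s0] := eqVneq s' 0.
  under eq_integral => w _.
    rewrite -dotE s0 /dotrv big1; last by move=> j _; rewrite mxE mul0r.
    rewrite expr0n mul0r expR0.
  over.
  by rewrite integral_cst_prob lee_fin ler1n.
have : (psi2_norm P (fun w => dotrv s' (z w) / l2norm s')%R < tau%:E)%E.
  apply: (@le_lt_trans _ _ sigma%:E); last by rewrite lte_fin.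
  by apply: le_trans hz; apply: ereal_sup_ubound; exists s'.
move=> /ereal_inf_lt[_ [t [t0 Et] <-]]; rewrite lte_fin => tt.
apply: le_trans Et; rewrite expectationE.
have l2 : l2norm s' ^+ 2 = \sum_j s j ^+ 2.
  rewrite /l2norm sqr_sqrtr.
    by apply: eq_bigr => j _; rewrite mxE.
  by apply: sumr_ge0 => j _; exact: sqr_ge0.
have l0 : 0 < l2norm s'.
  rewrite sqrtr_gt0 lt_neqAle eq_sym sumr_ge0 ?andbT; last first.
    by move=> j _; exact: sqr_ge0.
  apply: contra s0 => /eqP h; apply/eqP/rowP => j; rewrite [RHS]mxE; apply/eqP.
  rewrite -sqrf_eq0; apply/eqP; apply: (psumr_eq0P _ h) => // i _.
  exact: sqr_ge0.
apply: le_integral_nonneg => [| |w|w].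
- apply: measurableT_comp => //; apply: measurable_funM => //.
  exact: measurable_funX.
- apply: measurableT_comp => //; apply: measurable_funM => //.
  apply: measurable_funX; apply: measurable_funM => //.
  by under eq_fun do rewrite dotE.
- by rewrite expR_ge0.
- rewrite ler_expR dotE expr_div_n l2 -[leRHS]mulrA ler_wpM2l ?sqr_ge0//.
  rewrite -invfM lef_pV2 ?posrE; last 2 first.
  + by rewrite exprn_gt0// (lt_trans t0).
  + by rewrite mulr_gt0 ?exprn_gt0// -l2 exprn_gt0.
  apply: (@le_trans _ _ (t ^+ 2)).
    by rewrite ler_piMl ?sqr_ge0.
  by rewrite ler_pXn2r ?nnegrE ?ltW// (lt_trans t0).
Qed.

End psi2.

Section whitened.
Context {R : realType}.
Variables (p : nat) (lam : nat -> R).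
Hypothesis lam0 : forall j : 'I_p, 0 < lam j.+1.

Definition whiten (y : p.-tuple R) (j : 'I_p) : R :=
  tnth y j / Num.sqrt (lam j.+1).

Definition whiten_dot (s : 'I_p -> R) (y : p.-tuple R) : R :=
  \sum_j s j * whiten y j.

Lemma measurable_whiten j : measurable_fun setT (whiten ^~ j).
Proof.
apply: measurable_funM => //; exact: measurable_tnth.
Qed.

Lemma measurable_whiten_dot s : measurable_fun setT (whiten_dot s).
Proof.
apply: measurable_sum => j; apply: measurable_funM => //.
exact: measurable_whiten.
Qed.

Context {d0 : measure_display} {T0 : measurableType d0}.
Variables (P0 : probability T0 R) (x : {RV P0 >-> p.-tuple R}).
Hypotheses (hmean : mean_zero x) (hcov : has_second_moment x (Sigma p lam)).

Let mx j : measurable_fun setT (fun w => tnth (x w) j).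
Proof.
have mX : measurable_fun setT x by exact: measurable_funPT.
exact: (measurableT_comp (measurable_tnth j) mX).
Qed.

Let SigmaE (j k : 'I_p) : Sigma p lam j k = lam j.+1 * (j == k)%:R.
Proof. by rewrite !mxE; case: (j == k); rewrite ?mulr1 ?mulr0. Qed.

Let int_mul j k :
  (\int[P0]_w (tnth (x w) j * tnth (x w) k)%:E = (lam j.+1 * (j == k)%:R)%:E)%E.
Proof. by have := hcov j k; rewrite expectationE SigmaE. Qed.

Let integrable_sqr j :
  P0.-integrable setT (fun w => (tnth (x w) j * tnth (x w) j)%:E).
Proof.
apply/integrableP; split.
  by apply/measurable_EFinP; exact: measurable_funM.
under eq_integral do rewrite /= ger0_norm -?expr2 ?sqr_ge0// expr2.
by rewrite int_mul ltry.
Qed.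

Let integrable_mul j k :
  P0.-integrable setT (fun w => (tnth (x w) j * tnth (x w) k)%:E).
Proof.
apply: (le_integrable measurableT _ _
  (integrableD measurableT (integrable_sqr j) (integrable_sqr k))).
  by apply/measurable_EFinP; exact: measurable_funM.
move=> w _ /=; rewrite lee_fin; set a := tnth _ j; set b := tnth _ k.
rewrite [leRHS]ger0_norm; last by rewrite -!expr2 addr_ge0 ?sqr_ge0.
rewrite ler_norml; apply/andP; split.
  by have := sqr_ge0 (a + b); have := sqr_ge0 a; have := sqr_ge0 b; nra.
by have := sqr_ge0 (a - b); have := sqr_ge0 a; have := sqr_ge0 b; nra.
Qed.

Let integrable_coord j : P0.-integrable setT (fun w => (tnth (x w) j)%:E).
Proof.
have i1 : P0.-integrable setT (fun=> 1%:E).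
  apply/integrableP; split => //.
  under eq_integral do rewrite /= normr1.
  by rewrite integral_cst_prob ltry.
apply: (le_integrable measurableT _ _
  (integrableD measurableT i1 (integrable_sqr j))).
  by apply/measurable_EFinP.
move=> w _ /=; rewrite lee_fin; set a := tnth _ j.
rewrite [leRHS]ger0_norm; last by rewrite -!expr2 addr_ge0 ?sqr_ge0.
rewrite ler_norml; apply/andP; split.
  by have := sqr_ge0 (a + 1); have := sqr_ge0 a; nra.
by have := sqr_ge0 (a - 1); have := sqr_ge0 a; nra.
Qed.

Let whiten_dotE s y :
  whiten_dot s y = \sum_j (s j / Num.sqrt (lam j.+1)) * tnth y j.
Proof. by apply: eq_bigr => j _; rewrite /whiten; ring. Qed.

Lemma whiten_dot_integrable s :
  P0.-integrable setT (fun w => (whiten_dot s (x w))%:E).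
Proof.
rewrite (_ : (fun w => _) = (fun w =>
    (\sum_j (s j / Num.sqrt (lam j.+1))%:E * (tnth (x w) j)%:E)%E)).
  by apply: integrable_sum => // j _; exact: integrableZl.
by apply/funext => w; rewrite whiten_dotE -sumEFin.
Qed.

Lemma whiten_dot_mean s : (\int[P0]_w (whiten_dot s (x w))%:E = 0)%E.
Proof.
under eq_integral do rewrite whiten_dotE -sumEFin.
under eq_integral do under eq_bigr do rewrite EFinM.
rewrite integral_sum//; last by move=> j; exact: integrableZl.
rewrite big1// => j _; rewrite integralZl//.
by have := hmean j; rewrite expectationE => ->; rewrite mule0.
Qed.

Lemma whiten_dot_second_moment s :
  (\int[P0]_w (whiten_dot s (x w) ^+ 2)%:E = (\sum_j s j ^+ 2)%:E)%E.
Proof.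
pose r j := s j / Num.sqrt (lam j.+1).
have sqE w : (whiten_dot s (x w) ^+ 2)%:E = (\sum_j \sum_k (r j * r k)%:E *
    (tnth (x w) j * tnth (x w) k)%:E)%E.
  rewrite whiten_dotE expr2 mulr_suml -sumEFin; apply: eq_bigr => j _.
  rewrite mulr_sumr -sumEFin; apply: eq_bigr => k _.
  by rewrite -EFinM /r; congr EFin; ring.
under eq_integral do rewrite sqE.
have iZ j k : P0.-integrable setT (fun w => (r j * r k)%:E *
    (tnth (x w) j * tnth (x w) k)%:E)%E by exact: integrableZl.
rewrite integral_sum//; last by move=> j; exact: integrable_sum.
rewrite -sumEFin; apply: eq_bigr => j _.
rewrite integral_sum// (bigD1 j)//= big1 ?adde0.
  rewrite integralZl// int_mul eqxx mulr1 -EFinM; congr EFin.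
  rewrite /r -[X in _ * X](sqr_sqrtr (ltW (lam0 j))); field.
  by rewrite gt_eqF// sqrtr_gt0.
by move=> k kj; rewrite integralZl// int_mul eq_sym (negPf kj) mulr0 mule0.
Qed.

End whitened.

(** * Tail bounds for the rows of the design *)

Section rows.
Context {R : realType}.
Variables (p : nat) (lam : nat -> R).
Hypothesis lam0 : forall j : 'I_p, 0 < lam j.+1.
Context {d0 : measure_display} {T0 : measurableType d0}.
Variables (P0 : probability T0 R) (x : {RV P0 >-> p.-tuple R}).
Hypotheses (hmean : mean_zero x) (hcov : has_second_moment x (Sigma p lam)).
Context {d : measure_display} {T : measurableType d}.
Variables (P : probability T R) (n : nat) (X : 'I_n -> {RV P >-> p.-tuple R}).
Hypotheses (hindep : mutually_independent X) (hlaw : forall i, same_law (X i) x).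
Variables (sigma tau : R).
Hypotheses (sigma0 : 0 < sigma) (st : sigma < tau).
Hypothesis hpsi2 : forall i : 'I_n,
  (psi2_vnorm P (fun w => row i (data_matrix X w *m Sigma_invsqrt p lam))
          <= sigma%:E)%E.

Let v := tau ^+ 2.
Let v0 : 0 < v. Proof. by rewrite exprn_gt0// (lt_trans sigma0). Qed.

Lemma integral_row (i : 'I_n) (f : p.-tuple R -> R) :
  measurable_fun setT f -> (forall y, 0 <= f y) ->
  (\int[P]_w (f (X i w))%:E = \int[P0]_w (f (x w))%:E)%E.
Proof.
move=> mf f0; have mEf : measurable_fun setT (EFin \o f) by exact/measurable_EFinP.
have Ef0 y : (0 <= (EFin \o f) y)%E by rewrite lee_fin.
rewrite -(ge0_integral_distribution (X i) mEf Ef0).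
rewrite -(ge0_integral_distribution x mEf Ef0).
by apply: eq_measure_integral => B mB _; exact: hlaw.
Qed.

Let mrow i : measurable_fun setT (X i).
Proof. exact: measurable_funPT. Qed.

Lemma row_psi2 i (s : 'I_p -> R) : \sum_j s j ^+ 2 <= 1 ->
  (\int[P]_w (expR (whiten_dot lam s (X i w) ^+ 2 / v))%:E <= 2%:E)%E.
Proof.
move=> s1; have zE w j : (row i (data_matrix X w *m Sigma_invsqrt p lam)) 0 j =
    whiten lam (X i w) j.
  by rewrite mxE mul_mx_diag !mxE.
have mz j : measurable_fun setT
    (fun w => (row i (data_matrix X w *m Sigma_invsqrt p lam)) 0 j).
  under eq_fun do rewrite zE.
  exact: (measurableT_comp (measurable_whiten lam j) (mrow i)).
have := psi2_vnorm_exp_le mz (hpsi2 i) st s1.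
apply: le_trans; rewrite le_eqVlt; apply/orP; left; apply/eqP.
apply: eq_integral => w _.
rewrite (eq_bigr (fun j => s j * whiten lam (X i w) j))// => j _.
by rewrite zE.
Qed.

Lemma whiten_dotZ (k : R) (s : 'I_p -> R) (y : p.-tuple R) :
  whiten_dot lam (fun j => k * s j) y = k * whiten_dot lam s y.
Proof. by rewrite /whiten_dot mulr_sumr; apply: eq_bigr => j _; rewrite mulrA. Qed.

Let le_sumsqr0 (s : 'I_p -> R) : \sum_j s j ^+ 2 <= 0 -> \sum_j s j ^+ 2 = 0.
Proof.
by move=> N0; apply/eqP; rewrite eq_le N0 sumr_ge0// => k _; exact: sqr_ge0.
Qed.

Let sumsqr0 (s : 'I_p -> R) j : \sum_j s j ^+ 2 <= 0 -> s j = 0.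
Proof.
move=> /le_sumsqr0 Ne; apply/eqP; rewrite -sqrf_eq0; apply/eqP.
by apply: (psumr_eq0P _ Ne) => // k _; exact: sqr_ge0.
Qed.

Let whiten_dot0 (s : 'I_p -> R) y : \sum_j s j ^+ 2 <= 0 ->
  whiten_dot lam s y = 0.
Proof.
by move=> s0; rewrite /whiten_dot big1// => j _; rewrite sumsqr0// mul0r.
Qed.

Let normalize (s : 'I_p -> R) : 0 < \sum_j s j ^+ 2 ->
  exists2 k : R, k ^+ 2 = (\sum_j s j ^+ 2)^-1 & \sum_j (k * s j) ^+ 2 = 1.
Proof.
move=> N0; have k2 : (Num.sqrt (\sum_j s j ^+ 2))^-1 ^+ 2 = (\sum_j s j ^+ 2)^-1.
  by rewrite exprVn sqr_sqrtr// ltW.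
exists (Num.sqrt (\sum_j s j ^+ 2))^-1 => //.
under eq_bigr do rewrite exprMn k2.
by rewrite -mulr_sumr mulVf// gt_eqF.
Qed.

Lemma row_psi2_scaled i (s : 'I_p -> R) : 0 < \sum_j s j ^+ 2 ->
  (\int[P]_w (expR (whiten_dot lam s (X i w) ^+ 2 / (v * \sum_j s j ^+ 2)))%:E
     <= 2%:E)%E.
Proof.
move=> N0; have [k k2 k1] := normalize N0.
have : \sum_j (k * s j) ^+ 2 <= 1 by rewrite k1.
move=> /(row_psi2 i); apply: le_trans; rewrite le_eqVlt; apply/orP; left.
apply/eqP; apply: eq_integral => w _; congr (expR _)%:E.
rewrite whiten_dotZ exprMn k2; field.
by rewrite !gt_eqF.
Qed.

(** Moments are known for [x] and exponential moments for the rows; equality of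
    the laws lets both be used together. *)
Lemma row_mgf_le i (s : 'I_p -> R) :
  (\int[P]_w (expR (whiten_dot lam s (X i w)))%:E
     <= (expR (3 * v * \sum_j s j ^+ 2))%:E)%E.
Proof.
have [N0|N0] := leP (\sum_j s j ^+ 2) 0.
  under eq_integral do rewrite whiten_dot0// expR0.
  by rewrite integral_cst_prob le_sumsqr0// mulr0 expR0.
have mf : measurable_fun setT (fun y => expR (whiten_dot lam s y)).
  by apply: measurableT_comp => //; exact: measurable_whiten_dot.
rewrite (integral_row i mf)//.
rewrite -mulrA; apply: subgaussian_mgf_le.
- exact: (measurableT_comp (measurable_whiten_dot lam s) (measurable_funPT x)).
- by rewrite mulr_gt0.
- rewrite -(@integral_row i (fun y => expR (whiten_dot lam s y ^+ 2 /
    (v * \sum_j s j ^+ 2)))).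
  + exact: row_psi2_scaled.
  + apply: measurableT_comp => //; apply: measurable_funM => //.
    apply: measurable_funX; exact: measurable_whiten_dot.
  + by move=> y; exact: expR_ge0.
- exact: whiten_dot_integrable.
- exact: (whiten_dot_mean hmean hcov).
Qed.

Lemma row_small_ball i (s : 'I_p -> R) : \sum_j s j ^+ 2 = 1 ->
  (\int[P]_w (expR (- (whiten_dot lam s (X i w) ^+ 2 / (16 * v ^+ 2))))%:E
     <= (expR (- (32 * v ^+ 2)^-1))%:E)%E.
Proof.
move=> s1.
rewrite (@integral_row i (fun y => expR (- (whiten_dot lam s y ^+ 2 /
  (16 * v ^+ 2))))); last 2 first.
- apply: measurableT_comp => //; apply: measurableT_comp => //.
  apply: measurable_funM => //.
  apply: measurable_funX; exact: measurable_whiten_dot.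
- by move=> y; exact: expR_ge0.
apply: subgaussian_small_ball => //.
- exact: (measurableT_comp (measurable_whiten_dot lam s) (measurable_funPT x)).
- rewrite -(@integral_row i (fun y => expR (whiten_dot lam s y ^+ 2 / v))).
  + by apply: row_psi2; rewrite s1.
  + apply: measurableT_comp => //; apply: measurable_funM => //.
    apply: measurable_funX; exact: measurable_whiten_dot.
  + by move=> y; exact: expR_ge0.
- by rewrite (whiten_dot_second_moment lam0 hcov) s1.
Qed.

Lemma rows_exp_sum_le (f : 'I_n -> p.-tuple R -> R) (M : 'I_n -> R) :
  (forall i, measurable_fun setT (f i)) -> (forall i, 0 <= M i) ->
  (forall i, (\int[P]_w (expR (f i (X i w)))%:E <= (M i)%:E)%E) ->
  (\int[P]_w (expR (\sum_i f i (X i w)))%:E <= (\prod_i M i)%:E)%E.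
Proof.
move=> mf M0 fM; under eq_integral do rewrite expR_sum.
apply: (indep_prod_expectation_le (f := fun i y => expR (f i y))) => //.
by move=> i; exact: measurableT_comp.
Qed.

Let e2 : 2 <= expR 1 :> R. Proof. by have := expR_ge1Dx (1 : R); lra. Qed.

Let prob_sum_gt (f : p.-tuple R -> R) :
  measurable_fun setT f ->
  (forall i, (\int[P]_w (expR (f (X i w)))%:E <= 2%:E)%E) ->
  (P [set w | 2 * n%:R < \sum_i f (X i w)]%R <= (expR (- n%:R))%:E)%E.
Proof.
move=> mf f2.
have mS : measurable_fun setT (fun w => \sum_i f (X i w)).
  by apply: measurable_sum => i; exact: (measurableT_comp mf (mrow i)).
have h := rows_exp_sum_le (fun=> mf) (fun=> ler0n _ 2) f2.
apply: (le_trans (chernoff_le (2 * n%:R) mS h)).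
rewrite prodr_const card_ord lee_fin mulr_natl -[X in X <= _]mulrC.
rewrite mulr2n opprD expRD -mulrA ler_piMr ?expR_ge0//.
rewrite expRN mulrC ler_pdivrMr ?expR_gt0// mul1r -[X in expR X]mulr1 expRM_natl.
by apply: lerXn2r; rewrite ?nnegrE ?expR_ge0.
Qed.

Lemma prob_direction_gt (s : 'I_p -> R) :
  (P [set w | 2 * v * n%:R * (\sum_j s j ^+ 2) <
     \sum_i whiten_dot lam s (X i w) ^+ 2]%R <= (expR (- n%:R))%:E)%E.
Proof.
set N := \sum_j s j ^+ 2; have [N0|N0] := leP N 0.
  rewrite (_ : [set w | _] = set0) ?measure0 ?lee_fin ?expR_ge0//.
  apply/seteqP; split => // w /=; rewrite /N le_sumsqr0// mulr0.
  by rewrite big1 ?ltxx// => i _; rewrite whiten_dot0// expr0n.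
have vN : 0 < v * N by exact: mulr_gt0.
have -> : [set w | 2 * v * n%:R * N < \sum_i whiten_dot lam s (X i w) ^+ 2] =
    [set w | 2 * n%:R < \sum_i (whiten_dot lam s (X i w) ^+ 2 / (v * N))].
  apply/funext => w; apply/propext => /=.
  have -> : 2 * v * n%:R * N = 2 * n%:R * (v * N) by ring.
  by rewrite -mulr_suml -(ltr_pdivlMr _ _ vN); split.
apply: (@prob_sum_gt (fun y => whiten_dot lam s y ^+ 2 / (v * N))).
  apply: measurable_funM => //; apply: measurable_funX.
  exact: measurable_whiten_dot.
by move=> i; exact: row_psi2_scaled.
Qed.

Lemma prob_unit_direction_lt (s : 'I_p -> R) : \sum_j s j ^+ 2 = 1 ->
  (P [set w | \sum_i whiten_dot lam s (X i w) ^+ 2 < n%:R / 4]%R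
    <= (expR (- (n%:R / (64 * v ^+ 2))))%:E)%E.
Proof.
move=> s1; pose c := 16 * v ^+ 2.
have c0 : 0 < c by rewrite mulr_gt0// exprn_gt0.
have -> : [set w | \sum_i whiten_dot lam s (X i w) ^+ 2 < n%:R / 4] =
    [set w | - (n%:R / (64 * v ^+ 2)) <
      \sum_i (- (whiten_dot lam s (X i w) ^+ 2 / c))].
  apply/funext => w; apply/propext => /=.
  rewrite sumrN ltrN2 -mulr_suml ltr_pdivrMr//.
  suff -> : n%:R / (64 * v ^+ 2) * c = n%:R / 4 by [].
  by rewrite /c; field; rewrite gt_eqF.
have mf : measurable_fun setT (fun y => - (whiten_dot lam s y ^+ 2 / c)).
  apply: measurableT_comp => //; apply: measurable_funM => //.
  apply: measurable_funX; exact: measurable_whiten_dot.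
have mS : measurable_fun setT
    (fun w => \sum_i - (whiten_dot lam s (X i w) ^+ 2 / c)).
  by apply: measurable_sum => i; exact: (measurableT_comp mf (mrow i)).
have h := rows_exp_sum_le (fun=> mf) (fun=> expR_ge0 _)
  (fun i => row_small_ball i s1).
apply: (le_trans (chernoff_le _ mS h)).
rewrite prodr_const card_ord -expRM_natl -expRD lee_fin ler_expR opprK.
rewrite le_eqVlt; apply/orP; left; apply/eqP; field.
by rewrite gt_eqF.
Qed.

Lemma prob_direction_lt (s : 'I_p -> R) :
  (P [set w | \sum_i whiten_dot lam s (X i w) ^+ 2 <
        n%:R / 4 * (\sum_j s j ^+ 2)]%R
    <= (expR (- (n%:R / (64 * v ^+ 2))))%:E)%E.
Proof.
have [N0|N0] := leP (\sum_j s j ^+ 2) 0.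
  rewrite (_ : [set w | _] = set0) ?measure0 ?lee_fin ?expR_ge0//.
  apply/seteqP; split => // w /=; rewrite le_sumsqr0// mulr0 big1 ?ltxx// => i _.
  by rewrite whiten_dot0// expr0n.
have [k k2 k1] := normalize N0.
have := prob_unit_direction_lt k1.
rewrite (_ : [set w | _] = [set w | \sum_i whiten_dot lam s (X i w) ^+ 2 <
        n%:R / 4 * (\sum_j s j ^+ 2)])//.
apply/funext => w; apply/propext => /=.
under eq_bigr do rewrite whiten_dotZ exprMn k2.
by rewrite -mulr_sumr ltr_pdivrMl// mulrC.
Qed.

(** The coordinates of a row may be dependent; Jensen's inequality for the
    weights [c_j / L] reduces the exponential moment to those of single
    coordinates. *)
Lemma prob_weighted_coords_gt (c : 'I_p -> R) :
  (forall j, 0 <= c j) ->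
  (P [set w | 2 * v * n%:R * (\sum_j c j) <
     \sum_i \sum_j c j * whiten lam (X i w) j ^+ 2]%R
    <= (expR (- n%:R))%:E)%E.
Proof.
move=> c0; set L := \sum_j c j.
have [L0|L0] := leP L 0.
  have Le : L = 0 by apply/eqP; rewrite eq_le L0 sumr_ge0.
  have cj j : c j = 0 by apply: (psumr_eq0P _ Le).
  rewrite (_ : [set w | _] = set0) ?measure0 ?lee_fin ?expR_ge0//.
  apply/seteqP; split => // w /=; rewrite Le mulr0 big1 ?ltxx// => i _.
  by rewrite big1// => j _; rewrite cj mul0r.
pose f y := \sum_j (c j / L) * (whiten lam y j ^+ 2 / v).
have -> : [set w | 2 * v * n%:R * L <
     \sum_i \sum_j c j * whiten lam (X i w) j ^+ 2] =
    [set w | 2 * n%:R < \sum_i f (X i w)].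
  apply/funext => w; apply/propext => /=.
  have -> : \sum_i f (X i w) =
      (\sum_i \sum_j c j * whiten lam (X i w) j ^+ 2) / (v * L).
    rewrite mulr_suml; apply: eq_bigr => i _; rewrite mulr_suml.
    by apply: eq_bigr => j _; field; rewrite !gt_eqF.
  have -> : 2 * v * n%:R * L = 2 * n%:R * (v * L) by ring.
  have vL : 0 < v * L by exact: mulr_gt0.
  by rewrite -(ltr_pdivlMr _ _ vL); split.
have mw (j : 'I_p) :
    measurable_fun setT (fun y : p.-tuple R => whiten lam y j ^+ 2 / v).
  apply: measurable_funM => //; apply: measurable_funX.
  exact: measurable_whiten.
apply: prob_sum_gt.
  by apply: measurable_sum => j; apply: measurable_funM.
move=> i.
have jensen y : expR (f y) <= \sum_j (c j / L) * expR (whiten lam y j ^+ 2 / v).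
  have w1 : \sum_j c j / L = 1 by rewrite -mulr_suml divff// gt_eqF.
  (* the tangent of exp at the weighted mean f y *)
  have -> : expR (f y) = \sum_j (c j / L) *
      (expR (f y) * (1 + (whiten lam y j ^+ 2 / v - f y))).
    under eq_bigr do rewrite mulrCA.
    rewrite -mulr_sumr -[LHS]mulr1; congr (_ * _).
    under eq_bigr do rewrite mulrDr mulr1 mulrBr.
    have fE : \sum_j c j / L * f y = f y by rewrite -mulr_suml w1 mul1r.
    by rewrite big_split sumrB /= w1 fE subrr addr0.
  apply: ler_sum => j _; apply: ler_wpM2l; first by rewrite divr_ge0// ltW.
  rewrite -[leRHS](_ : expR (f y) * expR (whiten lam y j ^+ 2 / v - f y) = _).
    by rewrite ler_wpM2l ?expR_ge0// expR_ge1Dx.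
  by rewrite -expRD addrC subrK.
have mexp j : measurable_fun setT (fun w => expR (whiten lam (X i w) j ^+ 2 / v)).
  apply: measurableT_comp => //.
  exact: (measurableT_comp (mw j) (mrow i)).
apply: (@le_trans _ _ (\int[P]_w
    (\sum_j (c j / L) * expR (whiten lam (X i w) j ^+ 2 / v))%:E)%E).
  apply: le_integral_nonneg => [| |w|w].
  - apply: measurableT_comp => //.
    by apply: measurable_sum => j; apply: measurable_funM => //;
      exact: (measurableT_comp (mw j) (mrow i)).
  - by apply: measurable_sum => j; exact: measurable_funM.
  - by rewrite expR_ge0.
  - exact: jensen.
under eq_integral do rewrite -sumEFin.
under eq_integral do under eq_bigr do rewrite (EFinM (c _ / L)).
rewrite ge0_integral_sum//; last 2 first.
- by move=> j; apply/measurable_EFinP; exact: measurable_funM.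
- by move=> j w _; rewrite -EFinM lee_fin mulr_ge0 ?expR_ge0// divr_ge0// ltW.
apply: (@le_trans _ _ (\sum_j (c j / L * 2)%:E)%E).
  apply: lee_sum => j _; rewrite ge0_integralZl_EFin//; last 2 first.
  - exact/measurable_EFinP.
  - by rewrite divr_ge0// ltW.
  have cL0 : 0 <= c j / L by rewrite divr_ge0 ?(ltW L0).
  rewrite (EFinM (c j / L)) lee_wpmul2l ?lee_fin//.
  have dE w : whiten lam (X i w) j = whiten_dot lam (fun k => (k == j)%:R) (X i w).
    rewrite /whiten_dot (bigD1 j)//= eqxx mul1r big1 ?addr0// => k /negPf ->.
    by rewrite mul0r.
  under eq_integral do rewrite dE.
  apply: row_psi2; rewrite (bigD1 j)//= eqxx expr1n big1 ?addr0// => k /negPf ->.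
  by rewrite expr0n.
rewrite sumEFin -mulr_suml.
by rewrite -mulr_suml divff ?gt_eqF// mul1r.
Qed.

(** A combination of the independent rows with coefficients in the unit ball is a
    sub-Gaussian vector with the same constant, so the bound on quadratic
    forms applies to it.  Jensen's inequality would only give the sum of
    the [c_j] times [n] in place of the sum plus [n] times their
    maximum. *)
Lemma prob_combination_gt (u : 'cV[R]_n) (c : 'I_p -> R) (y : R) :
  nsq u <= 1 -> (forall j, 0 <= c j) -> (forall j, 24 * v * c j <= 1) ->
  (P [set w | y < \sum_j c j * (\sum_i u i 0 * whiten lam (X i w) j) ^+ 2]%R
    <= (expR (12 * v * (\sum_j c j) - y))%:E)%E.
Proof.
move=> u1 c0 vc.
have mg j : measurable_fun setT (fun w => \sum_i u i 0 * whiten lam (X i w) j).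
  apply: measurable_sum => i; apply: measurable_funM => //.
  exact: (measurableT_comp (measurable_whiten lam j) (mrow i)).
rewrite expRD; apply: chernoff_le.
  apply: measurable_sum => j; apply: measurable_funM => //.
  exact: measurable_funX.
rewrite (_ : 12 * v = 4 * (3 * v)); last by ring.
apply: exp_quadratic_form_le => //.
- by rewrite mulr_ge0// ltW.
- by move=> j; rewrite (_ : 8 * (3 * v) = 24 * v)//; ring.
move=> s.
under eq_integral => w _.
  rewrite (_ : \sum_j _ = \sum_i whiten_dot lam (fun j => u i 0 * s j) (X i w)).
  over.
  rewrite /whiten_dot [RHS]exchange_big; apply: eq_bigr => j _ /=.
  by rewrite mulr_sumr; apply: eq_bigr => i _; ring.
apply: le_trans (rows_exp_sum_le (fun i => measurable_whiten_dot lam _)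
  (fun i => expR_ge0 _) (fun i => row_mgf_le i _)) _.
rewrite -expR_sum lee_fin ler_expR -mulr_sumr.
apply: ler_wpM2l; first by rewrite mulr_ge0// ltW.
under eq_bigr do under eq_bigr do rewrite exprMn.
under eq_bigr do rewrite -mulr_sumr.
rewrite -mulr_suml ler_piMl// sumr_ge0// => j _; exact: sqr_ge0.
Qed.

End rows.

(** * Measurability of bias and variance *)

Section measurable_matrices.
Context {R : realType} {d : measure_display} {T : measurableType d}.

Definition measurable_mx m k (M : T -> 'M[R]_(m, k)) : Prop :=
  forall i j, measurable_fun setT (fun w => M w i j).

(** Inversion is [y |-> y (y^2)^-1], and [z |-> z^-1] is a real power for
    nonnegative [z]. *)
Lemma measurable_fun_invr (f : T -> R) :
  measurable_fun setT f -> measurable_fun setT (fun w => (f w)^-1).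
Proof.
move=> mf.
rewrite (_ : (fun w => _) = (fun w => f w * (f w ^+ 2) `^ (- 1))).
  apply: measurable_funM => //.
  apply: (measurableT_comp (f := fun y : R => y `^ (- 1))).
    exact: measurable_powR.
  exact: measurable_funX.
apply/funext => w; rewrite powR_inv1 ?sqr_ge0//.
have [->|f0] := eqVneq (f w) 0; first by rewrite mul0r invr0.
by field.
Qed.

Lemma measurable_mx_cst m k (A : 'M[R]_(m, k)) : measurable_mx (fun=> A).
Proof. by move=> i j; exact: measurable_cst. Qed.

Lemma measurable_mx_mul m k l (M : T -> 'M[R]_(m, k)) (N : T -> 'M[R]_(k, l)) :
  measurable_mx M -> measurable_mx N -> measurable_mx (fun w => M w *m N w).
Proof.
move=> mM mN i j; under eq_fun do rewrite mxE.
by apply: measurable_sum => h; exact: measurable_funM.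
Qed.

Lemma measurable_mx_add m k (M N : T -> 'M[R]_(m, k)) :
  measurable_mx M -> measurable_mx N -> measurable_mx (fun w => M w + N w).
Proof.
by move=> mM mN i j; under eq_fun do rewrite mxE; exact: measurable_funD.
Qed.

Lemma measurable_mx_opp m k (M : T -> 'M[R]_(m, k)) :
  measurable_mx M -> measurable_mx (fun w => - M w).
Proof.
by move=> mM i j; under eq_fun do rewrite mxE; exact: measurableT_comp.
Qed.

Lemma measurable_mx_tr m k (M : T -> 'M[R]_(m, k)) :
  measurable_mx M -> measurable_mx (fun w => (M w)^T).
Proof. by move=> mM i j; under eq_fun do rewrite mxE; exact: mM. Qed.

Lemma measurable_det m (M : T -> 'M[R]_m) :
  measurable_mx M -> measurable_fun setT (fun w => \det (M w)).
Proof.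
move=> mM; apply: measurable_sum => s; apply: measurable_funM => //.
by apply: measurable_prod => i _; exact: mM.
Qed.

(** Cramer's rule makes the entries rational functions. *)
Lemma measurable_mx_inv m (M : T -> 'M[R]_m) : measurable_mx M ->
  (forall w, M w \in unitmx) -> measurable_mx (fun w => invmx (M w)).
Proof.
move=> mM uM i j.
rewrite (_ : (fun w => _) = (fun w => (\det (M w))^-1 * cofactor (M w) j i)).
  apply: measurable_funM.
    by apply: measurable_fun_invr; exact: measurable_det.
  apply: measurable_funM => //; apply: measurable_det => k l.
  by under eq_fun do rewrite !mxE; exact: mM.
by apply/funext => w; rewrite /invmx uM !mxE.
Qed.

End measurable_matrices.

Section measurable_ridge.
Context {R : realType} {d : measure_display} {T : measurableType d}.
Variables (n p : nat) (lam : nat -> R) (lambda : R).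
Hypotheses (l0 : forall j : 'I_p, 0 < lam j.+1) (lambda0 : 0 < lambda).
Variable X : T -> 'M[R]_(n, p).
Hypothesis mX : measurable_mx X.

Let mA : measurable_mx (fun w => invmx (gramA lambda (X w))).
Proof.
apply: measurable_mx_inv => [|w]; last exact: gramA_unit.
apply: measurable_mx_add; first exact: measurable_mx_cst.
by apply: measurable_mx_mul => //; exact: measurable_mx_tr.
Qed.

Lemma measurable_ridge_bias theta :
  measurable_fun setT (fun w => ridge_bias lam lambda theta (X w)).
Proof.
under eq_fun do rewrite /ridge_bias mnorm_SigmaE//.
apply: measurable_sum => j; apply: measurable_funM => //.
apply: measurable_funX; apply: measurable_mx_mul; last exact: measurable_mx_cst.
apply: measurable_mx_add; first exact: measurable_mx_cst.
apply: measurable_mx_opp; apply: measurable_mx_mul => //.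
by apply: measurable_mx_mul => //; exact: measurable_mx_tr.
Qed.

Lemma measurable_ridge_variance :
  measurable_fun setT (fun w => ridge_variance lam lambda (X w)).
Proof.
apply: measurable_sum => i.
apply: (measurable_mx_mul _ mA).
apply: measurable_mx_mul; last exact: measurable_mx_tr.
apply: measurable_mx_mul; last exact: measurable_mx_cst.
exact: measurable_mx_mul.
Qed.

End measurable_ridge.

(** * The good event *)

Section union_bound.
Context {R : realType} {d : measure_display} {T : measurableType d}.
Variable P : probability T R.

Lemma prob_setU_le (A B : set T) (a b : R) : measurable A -> measurable B ->
  (P A <= a%:E)%E -> (P B <= b%:E)%E -> (P (A `|` B) <= (a + b)%:E)%E.
Proof.
move=> mA mB Aa Bb; apply: (le_trans (measureU2 _ mA mB)).
by rewrite EFinD leeD.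
Qed.

Lemma prob_exists_seq_le (V : eqType) (G : seq V) (A : V -> set T) (q : R) :
  (forall v, measurable (A v)) -> (forall v, v \in G -> (P (A v) <= q%:E)%E) ->
  measurable [set w | exists2 v, v \in G & A v w] /\
  (P [set w | exists2 v, v \in G & A v w] <= ((size G)%:R * q)%:E)%E.
Proof.
move=> mA; elim: G => [|v G IH] Aq.
  rewrite (_ : [set w | _] = set0).
    by rewrite measure0 mul0r; split.
  by apply/seteqP; split => // w [].
rewrite (_ : [set w | _] = A v `|` [set w | exists2 v, v \in G & A v w]).
  have [u uG|mU PU] := IH; first by apply: Aq; rewrite in_cons uG orbT.
  split; first exact: measurableU.
  rewrite /= -natr1 mulrDl mul1r addrC; apply: prob_setU_le => //.
  by apply: Aq; rewrite mem_head.
apply/seteqP; split => w.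
  by move=> [u]; rewrite in_cons => /orP[/eqP->|uG] Au; [left|right; exists u].
move=> [Av|[u uG Au]]; first by exists v; rewrite ?mem_head.
by exists u; rewrite // in_cons uG orbT.
Qed.

End union_bound.

Section good_events.
Context {R : realType}.
Variables (p : nat) (lam : nat -> R).
Hypothesis lam0 : forall j : 'I_p, 0 < lam j.+1.
Context {d0 : measure_display} {T0 : measurableType d0}.
Variables (P0 : probability T0 R) (x : {RV P0 >-> p.-tuple R}).
Hypotheses (hmean : mean_zero x) (hcov : has_second_moment x (Sigma p lam)).
Context {d : measure_display} {T : measurableType d}.
Variables (P : probability T R) (n : nat) (X : 'I_n -> {RV P >-> p.-tuple R}).
Hypotheses (hindep : mutually_independent X) (hlaw : forall i, same_law (X i) x).
Variables (sigma tau : R).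
Hypotheses (sigma0 : 0 < sigma) (st : sigma < tau).
Hypothesis hpsi2 : forall i : 'I_n,
  (psi2_vnorm P (fun w => row i (data_matrix X w *m Sigma_invsqrt p lam))
          <= sigma%:E)%E.
Hypothesis n0 : (0 < n)%N.

Let v := tau ^+ 2.
Let v0 : 0 < v. Proof. by rewrite exprn_gt0// (lt_trans sigma0). Qed.
Let nR : 0 < n%:R :> R. Proof. by rewrite ltr0n. Qed.
Let e2 : 2 <= expR 1 :> R. Proof. by have := expR_ge1Dx (1 : R); lra. Qed.

Lemma data_matrixE w i j :
  data_matrix X w i j = Num.sqrt (lam j.+1) * whiten lam (X i w) j.
Proof.
rewrite mxE /whiten mulrCA mulfV ?mulr1// gt_eqF// sqrtr_gt0.
exact: lam0.
Qed.

Lemma measurable_data_matrix : measurable_mx (data_matrix X).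
Proof.
move=> i j; under eq_fun do rewrite mxE.
have mXi : measurable_fun setT (X i) by exact: measurable_funPT.
exact: (measurableT_comp (measurable_tnth j) mXi).
Qed.

Lemma measurable_nsq_mulmx m k (M : T -> 'M[R]_(m, k)) (u : 'cV[R]_k) :
  measurable_mx M -> measurable_fun setT (fun w => nsq (M w *m u)).
Proof.
move=> mM; apply: measurable_sum => i; apply: measurable_funX.
by apply: measurable_mx_mul => //; exact: measurable_mx_cst.
Qed.

Lemma nsq_masked_trE (b : pred 'I_p) w (u : 'cV[R]_n) :
  nsq ((data_matrix X w *m mask b)^T *m u) =
  \sum_j ((b j)%:R * lam j.+1) * (\sum_i u i 0 * whiten lam (X i w) j) ^+ 2.
Proof.
rewrite /nsq; apply: eq_bigr => j _.
have -> : ((data_matrix X w *m mask b)^T *m u) j 0 =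
    (b j)%:R * Num.sqrt (lam j.+1) * \sum_i u i 0 * whiten lam (X i w) j.
  rewrite mxE mulr_sumr; apply: eq_bigr => i _.
  by rewrite mxE mul_maskE data_matrixE; ring.
by rewrite !exprMn sqr_sqrtr ?ltW//; case: (b j); rewrite ?expr1n ?expr0n.
Qed.

Lemma nsq_maskedE (b : pred 'I_p) w (u : 'cV[R]_p) :
  nsq (data_matrix X w *m mask b *m u) =
  \sum_i whiten_dot lam (fun j => (b j)%:R * (Num.sqrt (lam j.+1) * u j 0))
    (X i w) ^+ 2.
Proof.
rewrite /nsq; apply: eq_bigr => i _; congr (_ ^+ 2).
rewrite mxE; apply: eq_bigr => j _.
by rewrite mul_maskE data_matrixE; ring.
Qed.

(** The coefficient [al] is the largest for which [lam_j <= lambda / n] ensures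
    the hypothesis of [prob_combination_gt] on the form [al |Xb^T u|^2], whose
    trace is then at most [n / (24 v)].  The level [8 n] beats the
    [64^n <= exp (6 n)] points of the net with [r = 2]. *)
Lemma tail_opnorm_event (b : pred 'I_p) (lambda : R) : 0 < lambda ->
  (forall j, b j -> lam j.+1 * n%:R <= lambda) ->
  \sum_(j | b j) lam j.+1 <= lambda ->
  exists B : set T, [/\ measurable B, (P B <= (expR (- n%:R))%:E)%E &
    forall w, ~ B w -> forall u : 'cV[R]_n,
      nsq ((data_matrix X w *m mask b)^T *m u) <= 768 * v * lambda * nsq u].
Proof.
move=> lambda0 hb hs.
have [G [netG sizeG]] := @exists_net R n 2 isT.
pose A (u : 'cV[R]_n) := [set w | 192 * v * lambda <
  nsq ((data_matrix X w *m mask b)^T *m u)].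
have mM : measurable_mx (fun w => (data_matrix X w *m mask b)^T).
  apply: measurable_mx_tr; apply: measurable_mx_mul.
    exact: measurable_data_matrix.
  exact: measurable_mx_cst.
have mA u : measurable (A u).
  by apply: measurable_lt_set => //; exact: measurable_nsq_mulmx.
pose al := n%:R / (24 * v * lambda).
have al0 : 0 < al by rewrite divr_gt0// mulr_gt0// mulr_gt0.
pose c j := al * ((b j)%:R * lam j.+1).
have c0 j : 0 <= c j by rewrite mulr_ge0 ?(ltW al0)// mulr_ge0// ltW.
have c1 j : 24 * v * c j <= 1.
  have -> : 24 * v * c j = (b j)%:R * (lam j.+1 * n%:R) / lambda.
    by rewrite /c /al; field; rewrite !gt_eqF.
  rewrite ler_pdivrMr// mul1r; case: (boolP (b j)) => [/hb h|_].
    by rewrite mul1r.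
  by rewrite mul0r ltW.
have cs : 12 * v * (\sum_j c j) <= n%:R / 2.
  rewrite -mulr_sumr -sum_maskl.
  have -> : 12 * v * (al * \sum_(j | b j) lam j.+1) =
      n%:R / 2 / lambda * \sum_(j | b j) lam j.+1.
    by rewrite /al; field; rewrite !gt_eqF.
  by rewrite -mulrA ler_piMr ?divr_ge0// mulrC ler_pdivrMr// mul1r.
have PA u : nsq u <= 1 -> (P (A u) <= (expR (n%:R / 2 - 8 * n%:R))%:E)%E.
  move=> u1; have := prob_combination_gt hmean hcov hindep hlaw sigma0 st
    hpsi2 (8 * n%:R) u1 c0 c1.
  rewrite -/v (_ : [set w | _] = A u); last first.
    apply/funext => w; apply/propext; rewrite /A /= nsq_masked_trE.
    under eq_bigr do rewrite /c -mulrA.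
    rewrite -mulr_sumr -ltr_pdivrMl//.
    have -> : al^-1 * (8 * n%:R) = 192 * v * lambda.
      by rewrite /al; field; rewrite !gt_eqF.
    by [].
  by move=> /le_trans; apply; rewrite lee_fin ler_expR lerD2r.
pose A' u := if nsq u <= 1 then A u else set0.
have mA' u : measurable (A' u) by rewrite /A'; case: ifP.
have PA' u : u \in G -> (P (A' u) <= (expR (n%:R / 2 - 8 * n%:R))%:E)%E.
  move=> _; rewrite /A'; case: ifP => [/PA//|_].
  by rewrite measure0 lee_fin expR_ge0.
have [mU PU] := prob_exists_seq_le mA' PA'.
exists [set w | exists2 u, u \in G & A' u w]; split => //.
- apply: (le_trans PU); rewrite lee_fin.
  apply: (@le_trans _ _ (expR (6 * n%:R) * expR (n%:R / 2 - 8 * n%:R))).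
    rewrite ler_wpM2r ?expR_ge0//; apply: (le_trans sizeG).
    rewrite expRM_natr; apply: lerXn2r; rewrite ?nnegrE ?expR_ge0//.
    have -> : 4 * 2 ^+ (2 ^ 2) = 2 ^+ 6 :> R by ring.
    have -> : expR 6 = expR 1 ^+ 6 :> R by rewrite -expRM_natl mulr1.
    apply: lerXn2r; rewrite ?nnegrE ?expR_ge0//.
  by rewrite -expRD ler_expR; move: nR; set N := n%:R; lra.
- move=> w Bw u.
  rewrite (_ : 768 * v * lambda = 4 * (192 * v * lambda)); last by ring.
  apply: net_upper netG _ _.
    by rewrite natrX; lra.
  move=> y yG y1; rewrite leNgt; apply/negP => h; apply: Bw.
  by exists y => //; rewrite /A' y1.
Qed.

Section head.
Variable a : pred 'I_p.
Let N := #|a|.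
(* extension by zero of a vector indexed by the elements of a *)
Let pad (u : 'cV[R]_N) (j : 'I_p) : R :=
  \sum_k u k 0 * (enum_val k == j)%:R.

Let sum_enum (F : 'I_p -> R) :
  \sum_(j | a j) F j = \sum_(k < N) F (enum_val k).
Proof. by rewrite -big_enum_val; apply: eq_bigl. Qed.

Let pad_enum_val u k : pad u (enum_val k) = u k 0.
Proof.
rewrite /pad (bigD1 k)//= eqxx mulr1 big1 ?addr0// => l lk.
by rewrite (inj_eq enum_val_inj) (negPf lk) mulr0.
Qed.

Let pad_dot u (z : 'I_p -> R) :
  \sum_j pad u j * z j = \sum_k u k 0 * z (enum_val k).
Proof.
under eq_bigr do rewrite mulr_suml.
rewrite exchange_big; apply: eq_bigr => k _ /=.
rewrite (bigD1 (enum_val k))//= eqxx mulr1 big1 ?addr0// => j jk.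
by rewrite eq_sym (negPf jk) mulr0 mul0r.
Qed.

Let pad_nsq u : \sum_j pad u j ^+ 2 = nsq u.
Proof.
under eq_bigr do rewrite expr2.
by rewrite pad_dot; apply: eq_bigr => k _; rewrite pad_enum_val expr2.
Qed.

(** The net lives in the coordinates of [a], so its cardinality is exponential
    in [#|a|] and not in [p].  The upper tail bound on the net feeds
    [net_upper], whose constant [8 v n] is what [net_lower] needs; the
    condition [512 v <= r^2] makes the net fine enough for the lower bound
    [n / 4] at its points. *)
Lemma head_event r : (0 < r)%N -> 512 * v <= r%:R ^+ 2 -> 4 <= r%:R ^+ 2 :> R ->
  exists B : set T, [/\ measurable B,
    (P B <= ((4 * 2 ^+ (r ^ 2)) ^+ N *
       (expR (- n%:R) + expR (- (n%:R / (64 * v ^+ 2)))))%:E)%E &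
    forall w, ~ B w -> forall u : 'cV[R]_p,
      64^-1 * n%:R * (\sum_(j | a j) lam j.+1 * u j 0 ^+ 2) <=
      nsq (data_matrix X w *m mask a *m u)].
Proof.
move=> r0 rv r4; have [G [netG sizeG]] := @exists_net R N r r0.
pose M w : 'M[R]_(n, N) := \matrix_(i, k) whiten lam (X i w) (enum_val k).
have ME w u : nsq (M w *m u) = \sum_i whiten_dot lam (pad u) (X i w) ^+ 2.
  apply: eq_bigr => i _; congr (_ ^+ 2); rewrite /whiten_dot pad_dot mxE.
  by apply: eq_bigr => k _; rewrite mxE mulrC.
have mM : measurable_mx M.
  move=> i k; under eq_fun do rewrite mxE.
  have mXi : measurable_fun setT (X i) by exact: measurable_funPT.
  exact: (measurableT_comp (measurable_whiten lam (enum_val k)) mXi).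
pose A1 u := [set w | 2 * v * n%:R * nsq u < nsq (M w *m u)].
pose A2 u := [set w | nsq (M w *m u) < n%:R / 4 * nsq u].
have mA1 u : measurable (A1 u).
  by apply: measurable_lt_set => //; exact: measurable_nsq_mulmx.
have mA2 u : measurable (A2 u).
  by apply: measurable_lt_set => //; exact: measurable_nsq_mulmx.
have PA1 u : (P (A1 u) <= (expR (- n%:R))%:E)%E.
  have := prob_direction_gt hindep sigma0 st hpsi2 (pad u).
  rewrite pad_nsq -/v (_ : [set w | _] = A1 u)//.
  by apply/funext => w; rewrite /A1 /= ME.
have PA2 u : (P (A2 u) <= (expR (- (n%:R / (64 * v ^+ 2))))%:E)%E.
  have := prob_direction_lt lam0 hcov hindep hlaw sigma0 st hpsi2 (pad u).
  rewrite pad_nsq -/v (_ : [set w | _] = A2 u)//.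
  by apply/funext => w; rewrite /A2 /= ME.
have mA u : measurable (A1 u `|` A2 u) by exact: measurableU.
have PA u : u \in G -> (P (A1 u `|` A2 u) <=
    (expR (- n%:R) + expR (- (n%:R / (64 * v ^+ 2))))%:E)%E.
  by move=> _; exact: prob_setU_le.
have [mU PU] := prob_exists_seq_le mA PA.
exists [set w | exists2 u, u \in G & (A1 u `|` A2 u) w]; split => //.
  apply: (le_trans PU); rewrite lee_fin ler_wpM2r// addr_ge0// expR_ge0//.
move=> w Bw u.
have r2 : 0 < r%:R ^+ 2 :> R by rewrite exprn_gt0// ltr0n.
have e4 : (r ^ 2)%:R^-1 <= 4^-1 :> R by rewrite natrX lef_pV2// posrE.
have up : forall y, nsq (M w *m y) <= 4 * (2 * v * n%:R) * nsq y.
  apply: net_upper e4 netG _ => y yG y1; rewrite leNgt; apply/negP => h.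
  apply: Bw; exists y => //; left; rewrite /A1 /=; apply: le_lt_trans h.
  by rewrite ler_piMr// mulr_ge0// mulr_ge0// ltW.
have lo : forall y, n%:R / 4 / 16 * nsq y <= nsq (M w *m y).
  apply: (net_lower e4 _ _ _ netG up).
  - rewrite natrX ler_pdivrMr//.
    rewrite (_ : 4 * (2 * v * n%:R) = n%:R / 4 / 16 * (512 * v)); last by field.
    by rewrite ler_wpM2l// divr_ge0// divr_ge0.
  - by rewrite divr_ge0.
  - by rewrite mulr_ge0// mulr_ge0// mulr_ge0// ltW.
  - move=> y yG; rewrite leNgt; apply/negP => h.
    by apply: Bw; exists y => //; right.
pose u' : 'cV[R]_N := 
  \col_k (Num.sqrt (lam (enum_val k : 'I_p).+1) * u (enum_val k) 0).
have nu' : nsq u' = \sum_(j | a j) lam j.+1 * u j 0 ^+ 2.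
  rewrite (sum_enum (fun j : 'I_p => lam j.+1 * u j 0 ^+ 2)) /=.
  apply: eq_bigr => k _; rewrite mxE exprMn sqr_sqrtr// ltW//.
have nM : nsq (M w *m u') = nsq (data_matrix X w *m mask a *m u).
  apply: eq_bigr => i _; congr (_ ^+ 2); rewrite !mxE.
  under [RHS]eq_bigr do rewrite mul_maskE data_matrixE mulrAC mulrC.
  rewrite -sum_maskl.
  rewrite (sum_enum (fun j : 'I_p => Num.sqrt (lam j.+1) *
    whiten lam (X i w) j * u j 0)) /=.
  by apply: eq_bigr => k _; rewrite !mxE; ring.
have := lo u'; rewrite nu' nM; apply: le_trans.
by rewrite le_eqVlt; apply/orP; left; apply/eqP; field.
Qed.

End head.
End good_events.

(** * Large and small eigenvalues *)

Section spectrum.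
Context {R : realType}.
Variables (n p k : nat) (lam : nat -> R) (lambda c : R).
Hypotheses (n0 : (0 < n)%N) (k0 : (0 < k)%N) (kp : (k <= p)%N).
Hypothesis lam_dec : forall i j : nat,
  (1 <= i)%N -> (i <= j)%N -> (j <= p)%N -> lam j <= lam i.
Hypothesis lam_pos : 0 < lam p.
Hypotheses (c2 : 2 <= c) (kc : k%:R <= n%:R / c).
Hypothesis hlambda :
  c * n%:R * lam k + 2 * (\sum_(k.+1 <= i < p.+1) lam i) < lambda.
Let nR : 0 < n%:R :> R. Proof. by rewrite ltr0n. Qed.
Let c0 : 0 < c. Proof. by apply: lt_le_trans c2. Qed.

Lemma lam_gt0 i : (1 <= i <= p)%N -> 0 < lam i.
Proof. by move=> /andP[i1 ip]; apply: lt_le_trans lam_pos _; exact: lam_dec. Qed.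

Let tail := \sum_(k.+1 <= i < p.+1) lam i.

Let tail_ge0 : 0 <= tail.
Proof.
rewrite /tail big_nat_cond sumr_ge0// => i /andP[/andP[ki ip] _].
apply/ltW/lam_gt0/andP; split; last by [].
exact: leq_ltn_trans ki.
Qed.

Let head_gt0 : 0 < c * n%:R * lam k.
Proof. by rewrite mulr_gt0 ?mulr_gt0// lam_gt0// k0. Qed.

Lemma ridge_gt0 : 0 < lambda.
Proof. by move: hlambda head_gt0 tail_ge0; rewrite -/tail; lra. Qed.

Lemma lam_small_after i : (k <= i)%N -> (i <= p)%N -> lam i <= lambda / n%:R.
Proof.
move=> ki ip; rewrite ler_pdivlMr//.
have h : lam i <= lam k by exact: lam_dec.
have h1 : lam i * n%:R <= lam k * n%:R by rewrite ler_pM2r.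
have h2 : 0 < lam k * n%:R by rewrite mulr_gt0// lam_gt0// k0.
have h3 : 0 <= (c - 1) * (lam k * n%:R).
  by rewrite mulr_ge0 ?(ltW h2)// subr_ge0; move: c2; lra.
by move: hlambda tail_ge0; rewrite -/tail; lra.
Qed.

Lemma card_large_eigenvalues :
  (#|[pred j : 'I_p | (lambda / n%:R < lam j.+1)%R]| <= k)%N.
Proof.
rewrite cardE -(size_map val) -[X in (_ <= X)%N](size_iota 0).
apply: uniq_leq_size; first by rewrite (map_inj_uniq val_inj) enum_uniq.
move=> i /mapP[j]; rewrite mem_enum inE => aj ->; rewrite mem_iota /= add0n.
rewrite ltnNge; apply/negP => kj; move: aj; rewrite ltNge => /negP; apply.
by apply: lam_small_after => //; exact: leqW.
Qed.

(** The first [k] indices contribute at most [k lambda / n <= lambda / c], the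
    remaining ones at most [lambda / 2]. *)
Lemma sum_small_eigenvalues :
  \sum_(j < p | ~~ (lambda / n%:R < lam j.+1)) lam j.+1 <= lambda.
Proof.
have l0 := ridge_gt0.
rewrite (bigID (fun j : 'I_p => (j < k)%N)) /=.
have h1 : \sum_(j < p | ~~ (lambda / n%:R < lam j.+1) && (j < k)%N) lam j.+1
    <= lambda / c.
  apply: (@le_trans _ _ (\sum_(j < p | (j < k)%N) lambda / n%:R)).
    rewrite [leRHS]big_mkcond [leLHS]big_mkcond; apply: ler_sum => j _.
    rewrite -leNgt; case: (j < k)%N; rewrite ?andbF// andbT.
    by case: ifP => // _; rewrite divr_ge0// ltW.
  rewrite -(big_ord_widen _ (fun=> lambda / n%:R))// sumr_const card_ord.
  rewrite -[_ *+ k]mulr_natl.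
  apply: (@le_trans _ _ (n%:R / c * (lambda / n%:R))).
    by rewrite ler_wpM2r// divr_ge0// ltW.
  by rewrite le_eqVlt; apply/orP; left; apply/eqP; field; rewrite !gt_eqF.
have h2 : \sum_(j < p | ~~ (lambda / n%:R < lam j.+1) && ~~ (j < k)%N) lam j.+1
    <= tail.
  rewrite /tail big_add1 /= big_geq_mkord.
  rewrite [leRHS]big_mkcond [leLHS]big_mkcond; apply: ler_sum => j _.
  rewrite -leqNgt; case: (k <= j)%N; rewrite ?andbF// andbT.
  by case: ifP => // _; rewrite ltW// lam_gt0//=.
have h3 : lambda / c <= lambda / 2 by rewrite ler_pM2l// lef_pV2// posrE.
by move: h1 h2 h3 hlambda head_gt0; rewrite -/tail; lra.
Qed.

End spectrum.

(** With [c >= 2 D / e] the [D^N] points of the head net use up only half of the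
    rate [e]. *)
Lemma failure_prob_le (R : realType) (n N : nat) (D e c w : R) :
  0 < e -> e <= 1 -> e <= w -> 0 <= D -> 2 / e <= c -> 2 * D / e <= c ->
  N%:R <= n%:R / c ->
  expR (- n%:R) <= expR (- (n%:R / c)) /\
  D ^+ N * (expR (- n%:R) + expR (- (n%:R * w))) <= 2 * expR (- (n%:R / c)).
Proof.
move=> e0 e1 ew D0 ce cD Nc.
have c0 : 0 < c by apply: lt_le_trans ce; rewrite divr_gt0.
have n0 : 0 <= n%:R :> R by [].
have cinv : c^-1 <= e / 2.
  by rewrite -[leRHS]invrK lef_pV2 ?posrE ?invr_gt0 ?divr_gt0// invf_div.
have nc : n%:R / c <= n%:R * (e / 2) by rewrite ler_wpM2l.
have ne : n%:R * e <= n%:R by rewrite ler_piMr.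
have new : n%:R * e <= n%:R * w by rewrite ler_wpM2l.
have ne0 : 0 <= n%:R * e by rewrite mulr_ge0// ltW.
split; first by rewrite ler_expR lerN2; lra.
have DN : D ^+ N <= expR (n%:R * e / 2).
  apply: (@le_trans _ _ (expR D ^+ N)).
    apply: lerXn2r; rewrite ?nnegrE ?expR_ge0//.
    by have := expR_ge1Dx D; lra.
  rewrite -expRM_natl ler_expR.
  apply: (@le_trans _ _ (n%:R / c * D)); first by rewrite ler_wpM2r.
  have : D / c <= e / 2.
    by rewrite ler_pdivrMr//; move: cD; rewrite ler_pdivrMr// => h; lra.
  move=> h; rewrite mulrAC -mulrA -[leRHS]mulrA; apply: ler_wpM2l => //.
apply: (@le_trans _ _ (expR (n%:R * e / 2) * (2 * expR (- (n%:R * e))))).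
  apply: ler_pM => //; first exact: exprn_ge0.
  by rewrite [leRHS]mulr_natl mulr2n; apply: lerD; rewrite ler_expR lerN2.
rewrite mulrCA ler_pM2l// -expRD ler_expR; lra.
Qed.

Theorem corollary13 (R : realType) (sigma_x : R) (hsigma : 0 < sigma_x) :
  exists c : R, 0 < c /\
  forall (n p : nat) (hn : (0 < n)%N) (hnp : (n < p)%N)
    (hk : (1 <= Num.truncn (n%:R / c))%N)
    (lam : nat -> R)
    (hlam_dec : forall i j : nat, (1 <= i)%N -> (i <= j)%N -> (j <= p)%N ->
       lam j <= lam i)
    (hlam_pos : 0 < lam p)
    (d0 : measure_display) (T0 : measurableType d0) (P0 : probability T0 R)
    (x : {RV P0 >-> p.-tuple R})
    (hx_mean : mean_zero x)
    (hx_cov : has_second_moment x (Sigma p lam))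
    (d : measure_display) (T : measurableType d) (P : probability T R)
    (X : 'I_n -> {RV P >-> p.-tuple R})
    (hX_indep : mutually_independent X)
    (hX_law : forall i : 'I_n, same_law (X i) x)
    (hZ_subgauss : forall i : 'I_n,
       (psi2_vnorm P (fun w => row i (data_matrix X w *m Sigma_invsqrt p lam))
          <= sigma_x%:E)%E)
    (theta : 'cV[R]_p) (lambda : R)
    (hlambda : c * n%:R * lam (Num.truncn (n%:R / c))
         + 2 * (\sum_((Num.truncn (n%:R / c)).+1 <= i < p.+1) lam i) < lambda),
  ((1 - c * expR (- (n%:R / c)))%:E <=
   P [set w |
      (ridge_bias lam lambda theta (data_matrix X w) / c <=
         \sum_(i < p) lam i.+1 * `|theta i 0| ^+ 2 *
           ((lambda / n%:R) ^+ 2 / (lambda / n%:R + lam i.+1) ^+ 2)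
       /\
       ridge_variance lam lambda (data_matrix X w) / c <=
         n%:R^-1 * \sum_(i < p)
           (lam i.+1 ^+ 2 / (lambda / n%:R + lam i.+1) ^+ 2))%R])%E.
Proof.
(* any tau > sigma_x serves *)
pose tau := 2 * sigma_x; pose v := tau ^+ 2.
have st : sigma_x < tau by rewrite /tau; lra.
have v0 : 0 < v by rewrite exprn_gt0// mulr_gt0.
pose r := (Num.truncn (512 * v)).+2.
have rv1 : 512 * v <= r%:R.
  have h := truncnS_gt (512 * v).
  by rewrite (le_trans (ltW (truncnS_gt _)))// ler_nat.
have r2 : 2 <= r%:R :> R by rewrite ler_nat.
have rv : 512 * v <= r%:R ^+ 2 by nra.
have r4 : 4 <= r%:R ^+ 2 :> R by nra.
pose D : R := 4 * 2 ^+ (r ^ 2).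
have D0 : 0 <= D by rewrite mulr_ge0// exprn_ge0.
pose w64 := (64 * v ^+ 2)^-1.
have w640 : 0 < w64 by rewrite invr_gt0 mulr_gt0// exprn_gt0.
pose e := Num.min 1 w64.
have e0 : 0 < e by rewrite lt_min ltr01.
have e1 : e <= 1 by rewrite ge_min lexx.
have ew : e <= w64 by rewrite ge_min lexx orbT.
pose Kb := 4 * bias_const (768 * v) 64^-1 (2 * v).
pose Kv := 4 * ((6 + 4 * (768 * v) ^+ 2) / 64^-1 + 2 * v).
have C10 : 0 < 768 * v by apply: mulr_gt0 v0; rewrite ltr0n.
have c20 : 0 < 64^-1 :> R by rewrite invr_gt0.
have C30 : 0 <= 2 * v by rewrite mulr_ge0// ltW.
have Kb0 : 0 <= Kb by apply: mulr_ge0 => //; exact: bias_const_ge0.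
have Kv0 : 0 <= Kv by rewrite /Kv; nonneg.
have [c [c5 ce cD cb cv]] : exists c : R,
    [/\ 5 <= c, 2 / e <= c, 2 * D / e <= c, Kb <= c & Kv <= c].
  have ce0 : 0 <= 2 / e by nonneg.
  have cD0 : 0 <= 2 * D / e by nonneg.
  exists (5 + 2 / e + 2 * D / e + Kb + Kv); move: ce0 cD0 Kb0 Kv0.
  by move: (2 / e) (2 * D / e) Kb Kv => x1 x2 x3 x4 *; split; lra.
have c0 : 0 < c by apply: lt_le_trans c5; rewrite ltr0n.
exists c; split => //.
move=> n p hn hnp hk lam hdec hpos d0 T0 P0 x hmean hcov d T P X hindep hlaw
  hpsi theta lambda hlam.
set k := Num.truncn (n%:R / c) in hk hlam.
have nR : 0 < n%:R :> R by rewrite ltr0n.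
have kc : k%:R <= n%:R / c by rewrite truncn_le// divr_ge0// ltW.
have kp : (k <= p)%N.
  apply: leq_trans (ltnW hnp); rewrite -(ler_nat R) (le_trans kc)//.
  by rewrite ler_pdivrMr// ler_peMr//; lra.
have c2 : 2 <= c by lra.
have lam0 (j : 'I_p) : 0 < lam j.+1 by apply: lam_gt0 hdec hpos _ _ => /=.
have lambda0 : 0 < lambda by exact: (ridge_gt0 hn hk kp hdec hpos c2 hlam).
pose a (j : 'I_p) := lambda / n%:R < lam j.+1.
have Na : #|a|%:R <= n%:R / c.
  apply: le_trans kc; rewrite ler_nat.
  exact: (card_large_eigenvalues hn hk kp hdec hpos c2 hlam).
have Sa : \sum_(j | predC a j) lam j.+1 <= lambda.
  exact: (sum_small_eigenvalues hn hk kp hdec hpos c2 kc hlam).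
have hb j : predC a j -> lam j.+1 * n%:R <= lambda.
  by rewrite /= /a -leNgt ler_pdivlMr.
have [en eD] := failure_prob_le e0 e1 ew D0 ce cD Na.
have [B1 [mB1 PB1 HB1]] := tail_opnorm_event lam0 hmean hcov hindep hlaw
  hsigma st hpsi hn lambda0 hb Sa.
have [B2 [mB2 PB2 HB2]] := head_event lam0 hcov hindep hlaw hsigma st hpsi
  a (isT : (0 < r)%N) rv r4.
pose cf (j : 'I_p) := (predC a j)%:R * lam j.+1 ^+ 2.
have cf0 j : 0 <= cf j by rewrite mulr_ge0 ?sqr_ge0.
have PB3 := prob_weighted_coords_gt hindep hsigma st hpsi cf0.
set B3 := [set w | _] in PB3.
pose sf (j : 'I_p) := (predC a j)%:R * (Num.sqrt (lam j.+1) * theta j 0).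
have PB4 := prob_direction_gt hindep hsigma st hpsi sf.
set B4 := [set w | _] in PB4.
have mX i : measurable_fun setT (X i) by exact: measurable_funPT.
have mB3 : measurable B3.
  apply: measurable_lt_set => //; apply: measurable_sum => i.
  apply: measurable_sum => j; apply: measurable_funM => //.
  apply: measurable_funX.
  exact: (measurableT_comp (measurable_whiten lam j) (mX i)).
have mB4 : measurable B4.
  apply: measurable_lt_set => //; apply: measurable_sum => i.
  apply: measurable_funX.
  exact: (measurableT_comp (measurable_whiten_dot lam sf) (mX i)).
have mB34 : measurable (B3 `|` B4) by exact: measurableU.
have mB234 : measurable (B2 `|` (B3 `|` B4)) by exact: measurableU.
pose B := B1 `|` (B2 `|` (B3 `|` B4)).
have mB : measurable B by exact: measurableU.
have PB : (P B <= (c * expR (- (n%:R / c)))%:E)%E.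
  apply: (le_trans (prob_setU_le mB1 mB234 PB1
    (prob_setU_le mB2 mB34 PB2 (prob_setU_le mB3 mB4 PB3 PB4)))).
  rewrite lee_fin -/D -/w64.
  have E0 := expR_ge0 (- (n%:R / c)).
  have : 0 <= (c - 5) * expR (- (n%:R / c)) by rewrite mulr_ge0// subr_ge0.
  by move: en eD; rewrite /w64; lra.
set GS := [set w | _].
have mDM := measurable_data_matrix X.
have mGS : measurable GS.
  apply: measurableI; apply: measurable_le_set => //.
    by apply: measurable_funM => //; exact: measurable_ridge_bias.
  by apply: measurable_funM => //; exact: measurable_ridge_variance.
apply: (@le_trans _ _ (P (~` B))).
  rewrite probability_setC// EFinB; apply: leeB => //.
apply: le_measure; rewrite ?inE//; first exact: measurableC.
move=> w Bw.
have H1 := HB1 w (fun h => Bw (or_introl h)).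
have H2 := HB2 w (fun h => Bw (or_intror (or_introl h))).
have H3 : \sum_(j | ~~ a j) lam j.+1 * nsq (col j (data_matrix X w)) <=
    2 * v * n%:R * \sum_(j | ~~ a j) lam j.+1 ^+ 2.
  rewrite leNgt; apply/negP => h; apply: Bw; right; right; left.
  rewrite /B3 /=; move: h.
  have -> : \sum_j cf j = \sum_(j | ~~ a j) lam j.+1 ^+ 2.
    by rewrite [RHS](sum_maskl (predC a)).
  rewrite [X in _ < X -> _](_ : _ =
    \sum_i \sum_j cf j * whiten lam (X i w) j ^+ 2)//.
  rewrite (sum_maskl (predC a)) exchange_big; apply: eq_bigr => j _.
  rewrite /nsq !mulr_sumr; apply: eq_bigr => i _.
  by rewrite mxE (data_matrixE lam0) exprMn sqr_sqrtr ?ltW// /cf; ring.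
have H4 : nsq (data_matrix X w *m mask (predC a) *m theta) <=
    2 * v * n%:R * \sum_(j | ~~ a j) lam j.+1 * theta j 0 ^+ 2.
  rewrite leNgt; apply/negP => h; apply: Bw; right; right; right.
  rewrite /B4 /=; move: h; rewrite (nsq_maskedE lam0).
  have -> // : \sum_j sf j ^+ 2 = \sum_(j | ~~ a j) lam j.+1 * theta j 0 ^+ 2.
  rewrite [RHS](sum_maskl (predC a)); apply: eq_bigr => j _.
  rewrite /sf !exprMn sqr_sqrtr ?ltW//.
  by case: (predC a j); rewrite ?expr1n ?expr0n.
split.
- rewrite ler_pdivrMr//.
  apply: (le_trans (ridge_bias_le hn lam0 lambda0 C10 c20 C30 H1 H2 H4)).
  rewrite mulrC; apply: ler_wpM2l => //.
  apply: sumr_ge0 => j _; rewrite mulr_ge0//.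
    by rewrite mulr_ge0 ?sqr_ge0// ltW.
  by rewrite divr_ge0 ?sqr_ge0.
- rewrite ler_pdivrMr//.
  apply: (le_trans (ridge_variance_le hn lam0 lambda0 C10 c20 C30 H1 H2 H3)).
  rewrite [leRHS]mulrC; apply: ler_wpM2r => //.
  rewrite mulr_ge0 ?invr_ge0// sumr_ge0// => j _.
  by rewrite divr_ge0 ?sqr_ge0.
Qed.
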